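(* Let $\mathcal C$ be a strict braided monoidal category in which every idempotent splits and which admits coequalizers. Let $H$ be a weak Hopf quasigroup in $\mathcal C$ such that the functor $-\otimes H$ preserves coequalizers. For any right-right strong $H$-Hopf module $(M,\phi_M,\rho_M)\in\mathcal{SM}^H_H$, the objects $M^{co H}\otimes_{H_L}H$ and $M^{co H}\times H$ are isomorphic right-right $H$-Hopf modules (i.e. isomorphic in $\mathcal M^H_H$).
   Context: Conventions. $\mathcal C$ has tensor product $\otimes$, unit object $K$, braiding $c$. For an object $P$ and a morphism $f$, write $P\otimes f$ for $id_P\otimes f$ and $f\otimes P$ for $f\otimes id_P$. A unital magma is $(A,\eta_A,\mu_A)$ with $\eta_A:K\to A$, $\mu_A:A\otimes A\to A$ and $\mu_A\circ(A\otimes\eta_A)=id_A=\mu_A\circ(\eta_A\otimes A)$ (associativity not required; if associative, it is a monoid). A comonoid $(D,\varepsilon_D,\delta_D)$ is counital and coassociative. For $f,g:D\to A$ put $f\ast g=\mu_A\circ(f\otimes g)\circ\delta_D$. Put $\delta_{H\otimes H}=(H\otimes c_{H,H}\otimes H)\circ(\delta_H\otimes\delta_H)$. Weak Hopf quasigroup. $H$ is a unital magma $(H,\eta_H,\mu_H)$ and a comonoid $(H,\varepsilon_H,\delta_H)$ such that: (a1) $\delta_H\circ\mu_H=(\mu_H\otimes\mu_H)\circ\delta_{H\otimes H}$. (a2) $\varepsilon_H\circ\mu_H\circ(\mu_H\otimes H)=\varepsilon_H\circ\mu_H\circ(H\otimes\mu_H)=((\varepsilon_H\circ\mu_H)\otimes(\varepsilon_H\circ\mu_H))\circ(H\otimes\delta_H\otimes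 H)=((\varepsilon_H\circ\mu_H)\otimes(\varepsilon_H\circ\mu_H))\circ(H\otimes(c_{H,H}^{-1}\circ\delta_H)\otimes H)$. (a3) $(\delta_H\otimes H)\circ\delta_H\circ\eta_H=(H\otimes\mu_H\otimes H)\circ((\delta_H\circ\eta_H)\otimes(\delta_H\circ\eta_H))=(H\otimes(\mu_H\circ c_{H,H}^{-1})\otimes H)\circ((\delta_H\circ\eta_H)\otimes(\delta_H\circ\eta_H))$. (a4) There is $\lambda_H:H\to H$ (antipode) such that, with $\Pi_H^L=id_H\ast\lambda_H$ (target morphism) and $\Pi_H^R=\lambda_H\ast id_H$ (source morphism): (a4-1) $\Pi_H^L=((\varepsilon_H\circ\mu_H)\otimes H)\circ(H\otimes c_{H,H})\circ((\delta_H\circ\eta_H)\otimes H)$; (a4-2) $\Pi_H^R=(H\otimes(\varepsilon_H\circ\mu_H))\circ(c_{H,H}\otimes H)\circ(H\otimes(\delta_H\circ\eta_H))$; (a4-3) $\lambda_H\ast\Pi_H^L=\Pi_H^R\ast\lambda_H=\lambda_H$; (a4-4) $\mu_H\circ(\lambda_H\otimes\mu_H)\circ(\delta_H\otimes H)=\mu_H\circ(\Pi_H^R\otimes H)$; (a4-5) $\mu_H\circ(H\otimes\mu_H)\circ(H\otimes\lambda_H\otimes H)\circ(\delta_H\otimes H)=\mu_H\circ(\Pi_H^L\otimes H)$; (a4-6) $\mu_H\circ(\mu_H\otimes\lambda_H)\circ(H\otimes\delta_H)=\mu_H\circ(H\otimes\Pi_H^L)$; (a4-7) $\mu_H\circ(\mu_H\otimes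 H)\circ(H\otimes\lambda_H\otimes H)\circ(H\otimes\delta_H)=\mu_H\circ(H\otimes\Pi_H^R)$. The monoid $H_L$. $\Pi_H^L$ is idempotent (known). $H_L$ is its image, with $p_L:H\to H_L$, $i_L:H_L\to H$ such that $\Pi_H^L=i_L\circ p_L$, $p_L\circ i_L=id_{H_L}$. It is a monoid (known) with $\eta_{H_L}=p_L\circ\eta_H$ and $\mu_{H_L}=p_L\circ\mu_H\circ(i_L\otimes i_L)$. Hopf modules. A right-right $H$-Hopf module is $(M,\phi_M,\rho_M)$ with $\phi_M:M\otimes H\to M$, $\rho_M:M\to M\otimes H$ such that: (b1) $(M,\rho_M)$ is a right $H$-comodule; (b2-1) $\phi_M\circ(M\otimes\eta_H)=id_M$; (b2-2) $\rho_M\circ\phi_M=(\phi_M\otimes\mu_H)\circ(M\otimes c_{H,H}\otimes H)\circ(\rho_M\otimes\delta_H)$; (b3) $\phi_M\circ(\phi_M\otimes\lambda_H)\circ(M\otimes\delta_H)=\phi_M\circ(M\otimes\Pi_H^L)$; (b4) $\phi_M\circ(\phi_M\otimes H)\circ(M\otimes\lambda_H\otimes H)\circ(M\otimes\delta_H)=\phi_M\circ(M\otimes\Pi_H^R)$; (b5) $\phi_M\circ(\phi_M\otimes H)\circ(M\otimes\Pi_H^L\otimes H)\circ(M\otimes\delta_H)=\phi_M$. The morphism $q_M=\phi_M\circ(M\otimes\lambda_H)\circ\rho_M:M\to M$ is idempotent (known). $M^{co H}$ is its image, with $p_M:M\to M^{co H}$, $i_M:M^{co H}\to M$, $q_M=i_M\circ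 p_M$, $p_M\circ i_M=id$. Put $\phi_M^{\alpha_M}=\phi_M\circ(q_M\otimes\mu_H)\circ(\rho_M\otimes H):M\otimes H\to M$. A morphism of right-right $H$-Hopf modules $f:M\to N$ is a morphism of right $H$-comodules that is $H$-quasilineal, i.e. $\phi_N^{\alpha_N}\circ(f\otimes H)=f\circ\phi_M^{\alpha_M}$. The resulting category is $\mathcal M^H_H$. $\mathcal{SM}^H_H$ is its full subcategory of right-right strong $H$-Hopf modules, i.e. those satisfying $\phi_M\circ((\phi_M\circ(M\otimes i_L))\otimes H)=\phi_M\circ(M\otimes(\mu_H\circ(i_L\otimes H)))$. The object $M^{co H}\times H$. The morphism $\nabla_M=(p_M\otimes H)\circ\rho_M\circ\phi_M\circ(i_M\otimes H):M^{co H}\otimes H\to M^{co H}\otimes H$ is idempotent (known). $M^{co H}\times H$ is its image, with $p_{M^{co H}\otimes H}$, $i_{M^{co H}\otimes H}$ such that $i_{M^{co H}\otimes H}\circ p_{M^{co H}\otimes H}=\nabla_M$ and $p_{M^{co H}\otimes H}\circ i_{M^{co H}\otimes H}=id$. It is a right-right $H$-Hopf module (known) with $\phi_{M^{co H}\times H}=p_{M^{co H}\otimes H}\circ(M^{co H}\otimes\mu_H)\circ(i_{M^{co H}\otimes H}\otimes H)$ and $\rho_{M^{co H}\times H}=(p_{M^{co H}\otimes H}\otimes H)\circ(M^{co H}\otimes\delta_H)\circ i_{M^{co H}\otimes H}$. The object $M^{co H}\otimes_{H_L}H$. For $M$ strong, $M^{co H}$ is a right $H_L$-module with $\psi_{M^{co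 H}}=p_M\circ\phi_M\circ(i_M\otimes i_L)$. For a right $H_L$-module $(N,\psi_N)$, $n_N:N\otimes H\to N\otimes_{H_L}H$ denotes the coequalizer of $\psi_N\otimes H$ and $N\otimes\varphi_H$ as morphisms $N\otimes H_L\otimes H\to N\otimes H$, where $\varphi_H=\mu_H\circ(i_L\otimes H)$. When $-\otimes H$ preserves coequalizers, $N\otimes_{H_L}H$ is a right-right $H$-Hopf module, where $\rho_{N\otimes_{H_L}H}$ and $\phi_{N\otimes_{H_L}H}$ are the unique morphisms with $\rho_{N\otimes_{H_L}H}\circ n_N=(n_N\otimes H)\circ(N\otimes\delta_H)$ and $\phi_{N\otimes_{H_L}H}\circ(n_N\otimes H)=n_N\circ(N\otimes\mu_H)$. *)

(* Defs.v *)
Set Implicit Arguments.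
Unset Strict Implicit.
Unset Printing Implicit Defensive.

Declare Scope cat_scope.
Delimit Scope cat_scope with cat.
Open Scope cat_scope.

Reserved Notation "A ⊗ B" (at level 37, left associativity).
Reserved Notation "f ⊗ₘ g" (at level 37, left associativity).
Reserved Notation "P ◁ f" (at level 37, left associativity).
Reserved Notation "f ▷ P" (at level 37, left associativity).
Reserved Notation "g ∘ f" (at level 40, left associativity).
Reserved Notation "f ≡ g" (at level 70, no associativity).

Record category := Category {
  ob :> Type;
  hom : ob -> ob -> Type;
  idm : forall A : ob, hom A A;
  comp : forall A B D : ob, hom B D -> hom A B -> hom A D;
  comp_idl : forall (A B : ob) (f : hom A B), comp (idm B) f = f;
  comp_idr : forall (A B : ob) (f : hom A B), comp f (idm A) = f;
  comp_assoc : forall (A B D E : ob)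
      (h : hom D E) (g : hom B D) (f : hom A B),
    comp h (comp g f) = comp (comp h g) f
}.

Definition hcast (C : category) (A A' B B' : C) (eA : A = A') (eB : B = B')
    (f : hom A B) : hom A' B' :=
  match eA in _ = X, eB in _ = Y return hom X Y with
  | eq_refl, eq_refl => f
  end.

(* Strictness consists of equalities between objects, so that the two sides of
   an associativity or unit law for morphisms are compared along [hcast]. *)
Record strict_monoidal := StrictMonoidal {
  sm_cat :> category;
  tens : sm_cat -> sm_cat -> sm_cat;
  unit_ob : sm_cat;
  tens_assoc : forall A B D : sm_cat, tens (tens A B) D = tens A (tens B D);
  tens_unitl : forall A : sm_cat, tens unit_ob A = A;
  tens_unitr : forall A : sm_cat, tens A unit_ob = A;
  tensm : forall A A' B B' : sm_cat,
    hom A A' -> hom B B' -> hom (tens A B) (tens A' B');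
  tensm_id : forall A B : sm_cat, tensm (idm A) (idm B) = idm (tens A B);
  tensm_comp : forall (A A' A'' B B' B'' : sm_cat)
      (f' : hom A' A'') (f : hom A A') (g' : hom B' B'') (g : hom B B'),
    tensm (comp f' f) (comp g' g) = comp (tensm f' g') (tensm f g);
  tensm_assoc : forall (A A' B B' D D' : sm_cat)
      (f : hom A A') (g : hom B B') (h : hom D D'),
    hcast (tens_assoc A B D) (tens_assoc A' B' D') (tensm (tensm f g) h)
    = tensm f (tensm g h);
  tensm_unitl : forall (A A' : sm_cat) (f : hom A A'),
    hcast (tens_unitl A) (tens_unitl A') (tensm (idm unit_ob) f) = f;
  tensm_unitr : forall (A A' : sm_cat) (f : hom A A'),
    hcast (tens_unitr A) (tens_unitr A') (tensm f (idm unit_ob)) = f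
}.

Arguments unit_ob {s}.

Notation "A ⊗ B" := (tens A B) : cat_scope.
Notation "f ⊗ₘ g" := (tensm f g) : cat_scope.
Notation "P ◁ f" := (tensm (idm P) f) : cat_scope.
Notation "f ▷ P" := (tensm f (idm P)) : cat_scope.

(* [streq A B] is found by rewriting with [tens_assoc], [tens_unitl] and
   [tens_unitr]. It lets [g ∘ f] be written when the codomain of [f] and the
   domain of [g] agree only up to the strictness equalities, [f ≡ g] when
   sources and targets agree only up to them, and [retype f] for [f] seen as a
   morphism of the expected type. The choice of the proofs is
   immaterial by uniqueness of identity proofs; when the objects agree
   definitionally, the proof is [eq_refl] and [g ∘ f] is convertible to
   [comp g f]. *)
Class streq (C : strict_monoidal) (A B : C) : Prop := streq_eq : A = B.

Ltac solve_streq :=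
  first
    [ exact eq_refl
    | unfold streq;
      repeat first
        [ rewrite tens_assoc | rewrite tens_unitl | rewrite tens_unitr ];
      exact eq_refl ].

#[export] Hint Extern 0 (streq _ _) => solve_streq : typeclass_instances.

Definition scomp (C : strict_monoidal) (A B B' D : C)
    (g : hom B' D) (f : hom A B) {e : streq B B'} : hom A D :=
  comp g (hcast eq_refl e f).

Definition retype (C : strict_monoidal) (A A' B B' : C)
    (f : hom A B) {eA : streq A A'} {eB : streq B B'} : hom A' B' :=
  hcast eA eB f.

Definition eqm (C : strict_monoidal) (A A' B B' : C)
    (f : hom A B) (g : hom A' B') {eA : streq A A'} {eB : streq B B'} : Prop :=
  retype f = g.

Arguments scomp {C A B B' D} g f {e}.
Arguments retype {C A A' B B'} f {eA eB}.
Arguments eqm {C A A' B B'} f g {eA eB}.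

Notation "g ∘ f" := (scomp g f) : cat_scope.
Notation "f ≡ g" := (eqm f g) : cat_scope.

Record strict_braided := StrictBraided {
  sb_mon :> strict_monoidal;
  braid : forall A B : sb_mon, hom (A ⊗ B) (B ⊗ A);
  braid_inv : forall A B : sb_mon, hom (B ⊗ A) (A ⊗ B);
  braidK : forall A B : sb_mon, braid_inv A B ∘ braid A B = idm (A ⊗ B);
  braidVK : forall A B : sb_mon, braid A B ∘ braid_inv A B = idm (B ⊗ A);
  braid_nat : forall (A A' B B' : sb_mon) (f : hom A A') (g : hom B B'),
    braid A' B' ∘ (f ⊗ₘ g) = (g ⊗ₘ f) ∘ braid A B;
  braid_tensl : forall A B D : sb_mon,
    braid (A ⊗ B) D ≡ (braid A D ▷ B) ∘ (A ◁ braid B D);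
  braid_tensr : forall A B D : sb_mon,
    braid A (B ⊗ D) ≡ (B ◁ braid A D) ∘ (braid A B ▷ D)
}.

Definition is_splitting (C : category) (A I : C) (q : hom A A)
    (p : hom A I) (i : hom I A) : Prop :=
  comp i p = q /\ comp p i = idm I.

Definition idempotents_split (C : category) : Prop :=
  forall (A : C) (q : hom A A), comp q q = q ->
  exists (I : C) (p : hom A I) (i : hom I A), is_splitting q p i.

Definition is_coequalizer (C : category) (A B Q : C) (f g : hom A B)
    (n : hom B Q) : Prop :=
  comp n f = comp n g /\
  forall (X : C) (h : hom B X), comp h f = comp h g ->
    exists! k : hom Q X, comp k n = h.

Definition has_coequalizers (C : category) : Prop :=
  forall (A B : C) (f g : hom A B),
  exists (Q : C) (n : hom B Q), is_coequalizer f g n.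

Definition tensr_preserves_coequalizers (C : strict_monoidal) (P : C) : Prop :=
  forall (A B Q : C) (f g : hom A B) (n : hom B Q),
    is_coequalizer f g n -> is_coequalizer (f ▷ P) (g ▷ P) (n ▷ P).

Definition is_unital_magma (C : strict_monoidal) (A : C)
    (eta : hom unit_ob A) (mu : hom (A ⊗ A) A) : Prop :=
  mu ∘ (A ◁ eta) ≡ idm A /\ mu ∘ (eta ▷ A) ≡ idm A.

Definition is_comonoid (C : strict_monoidal) (D : C)
    (eps : hom D unit_ob) (delta : hom D (D ⊗ D)) : Prop :=
  (D ◁ eps) ∘ delta ≡ idm D /\ (eps ▷ D) ∘ delta ≡ idm D /\
  (delta ▷ D) ∘ delta ≡ (D ◁ delta) ∘ delta.

Definition convolution (C : strict_monoidal) (D A : C)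
    (delta : hom D (D ⊗ D)) (mu : hom (A ⊗ A) A) (f g : hom D A) : hom D A :=
  mu ∘ (f ⊗ₘ g) ∘ delta.

Record whq_data (C : strict_braided) := WhqData {
  whq_ob :> C;
  eta : hom unit_ob whq_ob;
  mu : hom (whq_ob ⊗ whq_ob) whq_ob;
  eps : hom whq_ob unit_ob;
  delta : hom whq_ob (whq_ob ⊗ whq_ob);
  lambda : hom whq_ob whq_ob
}.

Arguments eta {C} w.
Arguments mu {C} w.
Arguments eps {C} w.
Arguments delta {C} w.
Arguments lambda {C} w.

Definition hconv (C : strict_braided) (H : whq_data C) (f g : hom H H) :
    hom H H :=
  convolution (delta H) (mu H) f g.

Definition PiL (C : strict_braided) (H : whq_data C) : hom H H :=
  hconv (idm H) (lambda H).

Definition PiR (C : strict_braided) (H : whq_data C) : hom H H :=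
  hconv (lambda H) (idm H).

Definition delta2 (C : strict_braided) (H : whq_data C) :
    hom (H ⊗ H) (H ⊗ H ⊗ (H ⊗ H)) :=
  retype ((H ◁ braid H H ▷ H) ∘ (delta H ⊗ₘ delta H)).

Record is_weak_hopf_quasigroup (C : strict_braided) (H : whq_data C) : Prop := {
  whq_magma : is_unital_magma (eta H) (mu H);
  whq_comonoid : is_comonoid (eps H) (delta H);
  whq_a1 : delta H ∘ mu H = (mu H ⊗ₘ mu H) ∘ delta2 H;
  whq_a2_1 : eps H ∘ mu H ∘ (mu H ▷ H) ≡ eps H ∘ mu H ∘ (H ◁ mu H);
  whq_a2_2 : eps H ∘ mu H ∘ (H ◁ mu H) ≡
    ((eps H ∘ mu H) ⊗ₘ (eps H ∘ mu H)) ∘ (H ◁ delta H ▷ H);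
  whq_a2_3 : ((eps H ∘ mu H) ⊗ₘ (eps H ∘ mu H)) ∘ (H ◁ delta H ▷ H) ≡
    ((eps H ∘ mu H) ⊗ₘ (eps H ∘ mu H)) ∘
      (H ◁ (braid_inv H H ∘ delta H) ▷ H);
  whq_a3_1 : (delta H ▷ H) ∘ delta H ∘ eta H ≡
    (H ◁ mu H ▷ H) ∘ ((delta H ∘ eta H) ⊗ₘ (delta H ∘ eta H));
  whq_a3_2 : (H ◁ mu H ▷ H) ∘ ((delta H ∘ eta H) ⊗ₘ (delta H ∘ eta H)) ≡
    (H ◁ (mu H ∘ braid_inv H H) ▷ H) ∘
      ((delta H ∘ eta H) ⊗ₘ (delta H ∘ eta H));
  whq_a4_1 : PiL H ≡
    ((eps H ∘ mu H) ▷ H) ∘ (H ◁ braid H H) ∘ ((delta H ∘ eta H) ▷ H);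
  whq_a4_2 : PiR H ≡
    (H ◁ (eps H ∘ mu H)) ∘ (braid H H ▷ H) ∘ (H ◁ (delta H ∘ eta H));
  whq_a4_3l : hconv (lambda H) (PiL H) = lambda H;
  whq_a4_3r : hconv (PiR H) (lambda H) = lambda H;
  whq_a4_4 : mu H ∘ (lambda H ⊗ₘ mu H) ∘ (delta H ▷ H) ≡ mu H ∘ (PiR H ▷ H);
  whq_a4_5 : mu H ∘ (H ◁ mu H) ∘ (H ◁ lambda H ▷ H) ∘ (delta H ▷ H) ≡
    mu H ∘ (PiL H ▷ H);
  whq_a4_6 : mu H ∘ (mu H ⊗ₘ lambda H) ∘ (H ◁ delta H) ≡ mu H ∘ (H ◁ PiL H);
  whq_a4_7 : mu H ∘ (mu H ▷ H) ∘ (H ◁ lambda H ▷ H) ∘ (H ◁ delta H) ≡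
    mu H ∘ (H ◁ PiR H)
}.

Record weak_hopf_quasigroup (C : strict_braided) := WeakHopfQuasigroup {
  whq_carrier :> whq_data C;
  whq_axioms : is_weak_hopf_quasigroup whq_carrier
}.

Record hopf_data (C : strict_braided) (H : whq_data C) := HopfData {
  hd_ob :> C;
  act : hom (hd_ob ⊗ H) hd_ob;
  coact : hom hd_ob (hd_ob ⊗ H)
}.

Arguments HopfData {C H} hd_ob act coact.
Arguments act {C H} h.
Arguments coact {C H} h.

Definition is_right_comodule (C : strict_monoidal) (D M : C)
    (eps : hom D unit_ob) (delta : hom D (D ⊗ D)) (rho : hom M (M ⊗ D)) : Prop :=
  (M ◁ eps) ∘ rho ≡ idm M /\ (rho ▷ D) ∘ rho ≡ (M ◁ delta) ∘ rho.

Record is_hopf_module (C : strict_braided) (H : whq_data C)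
    (M : hopf_data H) : Prop := {
  hm_b1 : is_right_comodule (eps H) (delta H) (coact M);
  hm_b2_1 : act M ∘ (M ◁ eta H) ≡ idm M;
  hm_b2_2 : coact M ∘ act M ≡
    (act M ⊗ₘ mu H) ∘ (M ◁ braid H H ▷ H) ∘ (coact M ⊗ₘ delta H);
  hm_b3 : act M ∘ (act M ⊗ₘ lambda H) ∘ (M ◁ delta H) ≡ act M ∘ (M ◁ PiL H);
  hm_b4 : act M ∘ (act M ▷ H) ∘ (M ◁ lambda H ▷ H) ∘ (M ◁ delta H) ≡
    act M ∘ (M ◁ PiR H);
  hm_b5 : act M ∘ (act M ▷ H) ∘ (M ◁ PiL H ▷ H) ∘ (M ◁ delta H) ≡ act M
}.

Definition is_strong (C : strict_braided) (H : whq_data C) (HL : C)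
    (iL : hom HL H) (M : hopf_data H) : Prop :=
  act M ∘ ((act M ∘ (M ◁ iL)) ▷ H) ≡ act M ∘ (M ◁ (mu H ∘ (iL ▷ H))).

Definition q_hm (C : strict_braided) (H : whq_data C) (M : hopf_data H) :
    hom M M :=
  act M ∘ (M ◁ lambda H) ∘ coact M.

Definition act_alpha (C : strict_braided) (H : whq_data C) (M : hopf_data H) :
    hom (M ⊗ H) M :=
  act M ∘ (q_hm M ⊗ₘ mu H) ∘ (coact M ▷ H).

Record is_hopf_morphism (C : strict_braided) (H : whq_data C)
    (M N : hopf_data H) (f : hom M N) : Prop := {
  hmor_colinear : coact N ∘ f = (f ▷ H) ∘ coact M;
  hmor_quasilineal : act_alpha N ∘ (f ▷ H) = f ∘ act_alpha M
}.

Definition hopf_module_iso (C : strict_braided) (H : whq_data C)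
    (M N : hopf_data H) : Prop :=
  is_hopf_module M /\ is_hopf_module N /\
  exists (f : hom M N) (g : hom N M),
    is_hopf_morphism f /\ is_hopf_morphism g /\
    g ∘ f = idm M /\ f ∘ g = idm N.

Section Coinvariants.

Context (C : strict_braided) (H : whq_data C) (M : hopf_data H).
Context (McoH : C) (pM : hom M McoH) (iM : hom McoH M).

Definition nabla : hom (McoH ⊗ H) (McoH ⊗ H) :=
  (pM ▷ H) ∘ coact M ∘ act M ∘ (iM ▷ H).

Definition psi_co (HL : C) (iL : hom HL H) : hom (McoH ⊗ HL) McoH :=
  pM ∘ act M ∘ (iM ⊗ₘ iL).

End Coinvariants.

Definition phi_L (C : strict_braided) (H : whq_data C) (HL : C)
    (iL : hom HL H) : hom (HL ⊗ H) H :=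
  mu H ∘ (iL ▷ H).

(* The Hopf module carried by the image X of an idempotent of N ⊗ H, with
   projection p and inclusion i. *)
Definition times_hopf (C : strict_braided) (H : whq_data C) (N X : C)
    (p : hom (N ⊗ H) X) (i : hom X (N ⊗ H)) : hopf_data H :=
  HopfData X
    (p ∘ (N ◁ mu H) ∘ (i ▷ H))
    ((p ▷ H) ∘ (N ◁ delta H) ∘ i).

(* N ⊗_{H_L} H as the coequalizer of ψ ⊗ H and N ⊗ φ_H; the second morphism is
   transported along (N ⊗ H_L) ⊗ H = N ⊗ (H_L ⊗ H) to be parallel to the
   first. *)
Definition is_tensor_over_HL (C : strict_braided) (H : whq_data C) (HL : C)
    (iL : hom HL H) (N : C) (psi : hom (N ⊗ HL) N) (Q : C)
    (n : hom (N ⊗ H) Q) : Prop :=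
  is_coequalizer (psi ▷ H) (retype (N ◁ phi_L iL)) n.

(* Main.v *)
(* In Sweedler notation, rho(x h) = x h_1 ⊗ h_2 for x coinvariant; with (b3) this
   turns nabla(x ⊗ h) into x PiL(h_1) ⊗ h_2, which the coequalizer n sends to
   n(x ⊗ PiL(h_1) h_2) = n(x ⊗ h). Since nabla(x ⊗ h) is also (p ⊗ H) rho(x h),
   strongness (x z) h = x (z h) for z in H_L makes nabla coequalize the pair
   defining n. So pX and n factor through each other, and the resulting
   isomorphism preserves action and coaction.
   The axioms (b1)-(b5) are checked for N ⊗ H with mu and delta, descend to the
   quotient N ⊗_{H_L} H, and are then transported to N × H.
   The associativity needed, (h z) l = h (z l) and (z h) l = z (h l) for z in
   H_L, comes from a = eps(a_1) a_2 applied to both sides, eps being associative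
   on triple products by (a2). *)

Require Import Defs.
From Stdlib Require Import Eqdep ssreflect.

Set Implicit Arguments.
Unset Strict Implicit.
Unset Printing Implicit Defensive.

(** * Equality of morphisms up to the strictness equalities of objects *)

Local Notation "f ;; g" := (comp g f) (at level 60, right associativity).

(** Strictness only provides propositional equalities of objects. This relation compares morphisms
    across them and is compatible with [comp] and [tensm], so casts need not be tracked. *)
Definition heq (C : category) (A B A' B' : C) (f : hom A B) (g : hom A' B') :=
  exists (eA : A = A') (eB : B = B'), hcast eA eB f = g.

Lemma heq_refl (C : category) (A B : C) (f : hom A B) : heq f f.
Proof. by exists eq_refl, eq_refl. Qed.

Lemma heq_sym (C : category) (A B A' B' : C) (f : hom A B) (g : hom A' B') :
  heq f g -> heq g f.
Proof. case=> eA [eB <-]; destruct eA, eB; exact: heq_refl. Qed.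

Lemma heq_trans (C : category) (A B A' B' A'' B'' : C) (f : hom A B)
    (g : hom A' B') (h : hom A'' B'') : heq f g -> heq g h -> heq f h.
Proof. by case=> eA [eB <-]; destruct eA, eB. Qed.

(** Uniqueness of identity proofs turns both casts into identities. *)
Lemma heq_eq (C : category) (A B : C) (f g : hom A B) : heq f g -> f = g.
Proof. by case=> eA [eB <-]; rewrite (UIP_refl _ _ eA) (UIP_refl _ _ eB). Qed.

Lemma eq_heq (C : category) (A B : C) (f g : hom A B) : f = g -> heq f g.
Proof. move->; exact: heq_refl. Qed.

Lemma heq_hcast (C : category) (A B A' B' : C) (eA : A = A') (eB : B = B')
    (f : hom A B) : heq (hcast eA eB f) f.
Proof. destruct eA, eB; exact: heq_refl. Qed.

Lemma heq_comp (C : category) (A B D A' B' D' : C) (f : hom A B) (g : hom B D)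
    (f' : hom A' B') (g' : hom B' D') :
  heq f f' -> heq g g' -> heq (f ;; g) (f' ;; g').
Proof.
case=> eA [eB <-]; destruct eA, eB; case=> eB [eD <-]; destruct eD.
rewrite (UIP_refl _ _ eB); exact: heq_refl.
Qed.

Lemma heq_scomp (C : strict_monoidal) (A B B1 D A' B' D' : C) (f : hom A B)
    (g : hom B1 D) (e : streq B B1) (f' : hom A' B') (g' : hom B' D') :
  heq f f' -> heq g g' -> heq (scomp g f) (f' ;; g').
Proof.
move=> ff' gg'; apply: heq_comp gg'.
exact: heq_trans (heq_hcast _ _ _) ff'.
Qed.

Lemma heq_retype (C : strict_monoidal) (A A1 B B1 A' B' : C) (f : hom A B)
    (eA : streq A A1) (eB : streq B B1) (f' : hom A' B') :
  heq f f' -> heq (retype (A' := A1) (B' := B1) f) f'.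
Proof. apply: heq_trans; exact: heq_hcast. Qed.

Lemma eqm_heq (C : strict_monoidal) (A A' B B' : C) (f : hom A B)
    (g : hom A' B') (eA : streq A A') (eB : streq B B') :
  eqm f g (eA := eA) (eB := eB) -> heq f g.
Proof. move=> <-; apply: heq_sym; apply: heq_retype; exact: heq_refl. Qed.

Lemma heq_eqm (C : strict_monoidal) (A A' B B' : C) (f : hom A B)
    (g : hom A' B') (eA : streq A A') (eB : streq B B') :
  heq f g -> eqm f g (eA := eA) (eB := eB).
Proof. move=> fg; apply: heq_eq; exact: heq_retype. Qed.

Lemma heq_tensm (C : strict_monoidal) (A B D E A' B' D' E' : C) (f : hom A B)
    (g : hom D E) (f' : hom A' B') (g' : hom D' E') :
  heq f f' -> heq g g' -> heq (f ⊗ₘ g) (f' ⊗ₘ g').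
Proof.
case=> eA [eB <-]; case=> eD [eE <-]; destruct eA, eB, eD, eE.
exact: heq_refl.
Qed.

Lemma heq_tensm_assoc (C : strict_monoidal) (A B D A' B' D' : C)
    (f : hom A A') (g : hom B B') (h : hom D D') :
  heq (f ⊗ₘ g ⊗ₘ h) (f ⊗ₘ (g ⊗ₘ h)).
Proof.
apply: heq_trans (eq_heq (tensm_assoc f g h)); apply: heq_sym.
exact: heq_hcast.
Qed.

Lemma heq_tensm_unitr (C : strict_monoidal) (A A' : C) (f : hom A A') :
  heq (f ▷ unit_ob) f.
Proof.
apply: heq_trans (eq_heq (tensm_unitr f)); apply: heq_sym; exact: heq_hcast.
Qed.

Lemma heq_tensm_unitl (C : strict_monoidal) (A A' : C) (f : hom A A') :
  heq (unit_ob ◁ f) f.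
Proof.
apply: heq_trans (eq_heq (tensm_unitl f)); apply: heq_sym; exact: heq_hcast.
Qed.

Lemma heq_idm (C : category) (A A' : C) : A = A' -> heq (idm A) (idm A').
Proof. move->; exact: heq_refl. Qed.

Lemma tensm_compl (C : strict_monoidal) (Y A B D : C) (f : hom A B)
    (g : hom B D) : Y ◁ (f ;; g) = (Y ◁ f) ;; (Y ◁ g).
Proof. by rewrite -tensm_comp comp_idl. Qed.

Lemma tensm_compr (C : strict_monoidal) (Y A B D : C) (f : hom A B)
    (g : hom B D) : (f ;; g) ▷ Y = (f ▷ Y) ;; (g ▷ Y).
Proof. by rewrite -tensm_comp comp_idl. Qed.

Lemma tensm_lr (C : strict_monoidal) (A A' B B' : C) (f : hom A A')
    (g : hom B B') : f ⊗ₘ g = (f ▷ B) ;; (A' ◁ g).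
Proof. by rewrite -tensm_comp comp_idl comp_idr. Qed.

Lemma tensm_rl (C : strict_monoidal) (A A' B B' : C) (f : hom A A')
    (g : hom B B') : f ⊗ₘ g = (A ◁ g) ;; (f ▷ B').
Proof. by rewrite -tensm_comp comp_idl comp_idr. Qed.

Lemma whiskers_commute (C : strict_monoidal) (A A' B B' : C) (f : hom A A')
    (g : hom B B') : (A ◁ g) ;; (f ▷ B') = (f ▷ B) ;; (A' ◁ g).
Proof. by rewrite -tensm_rl tensm_lr. Qed.

Lemma heq_whisker (C : strict_monoidal) (Y A B A' B' : C) (f : hom A B)
    (f' : hom A' B') : heq f f' -> heq (f ▷ Y) (f' ▷ Y).
Proof. move=> ff'; apply: heq_tensm => //; exact: heq_refl. Qed.

Lemma heq_lwhisker (C : strict_monoidal) (Y A B A' B' : C) (f : hom A B)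
    (f' : hom A' B') : heq f f' -> heq (Y ◁ f) (Y ◁ f').
Proof. move=> ff'; apply: heq_tensm => //; exact: heq_refl. Qed.

Lemma heq_whisker2 (C : strict_monoidal) (Y Z A B A' B' : C) (f : hom A B)
    (f' : hom A' B') : heq f f' -> heq (f ▷ (Y ⊗ Z)) (f' ▷ Y ▷ Z).
Proof.
move=> ff'; rewrite -tensm_id.
apply: heq_trans (heq_sym (heq_tensm_assoc _ _ _)) _.
by do 2 apply: heq_whisker.
Qed.

Lemma heq_lwhisker_scomp (C : strict_monoidal) (Y A B B1 D A' B' D' : C)
    (f : hom A B) (g : hom B1 D) (e : streq B B1) (f' : hom A' B')
    (g' : hom B' D') :
  heq (Y ◁ f) f' -> heq (Y ◁ g) g' -> heq (Y ◁ scomp g f) (f' ;; g').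
Proof.
move=> ff' gg'; rewrite /scomp tensm_compl; apply: heq_comp gg'.
apply: heq_trans ff'; apply: heq_lwhisker; exact: heq_hcast.
Qed.

Lemma heq_lwhisker_comp (C : strict_monoidal) (Y A B D A' B' D' : C)
    (f : hom A B) (g : hom B D) (f' : hom A' B') (g' : hom B' D') :
  heq (Y ◁ f) f' -> heq (Y ◁ g) g' -> heq (Y ◁ (f ;; g)) (f' ;; g').
Proof. by move=> ff' gg'; rewrite tensm_compl; apply: heq_comp. Qed.

Lemma heq_lwhisker_retype (C : strict_monoidal) (Y A A1 B B1 A' B' : C)
    (f : hom A B) (eA : streq A A1) (eB : streq B B1) (f' : hom A' B') :
  heq (Y ◁ f) f' -> heq (Y ◁ retype (A' := A1) (B' := B1) f) f'.
Proof. apply: heq_trans; apply: heq_lwhisker; exact: heq_hcast. Qed.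

Lemma heq_lwhisker_id (C : strict_monoidal) (Y A B : C) :
  Y ⊗ A = B -> heq (Y ◁ idm A) (idm B).
Proof. by rewrite tensm_id; apply: heq_idm. Qed.

Lemma heq_lwhisker_lwhisker (C : strict_monoidal) (Y Z A B A' B' : C)
    (f : hom A B) (f' : hom A' B') :
  heq ((Y ⊗ Z) ◁ f) f' -> heq (Y ◁ (Z ◁ f)) f'.
Proof.
apply: heq_trans; rewrite -tensm_id; apply: heq_sym; exact: heq_tensm_assoc.
Qed.

Lemma heq_lwhisker_assoc (C : strict_monoidal) (Y Z W A B A' B' : C)
    (f : hom A B) (f' : hom A' B') :
  heq ((Y ⊗ Z ⊗ W) ◁ f) f' -> heq ((Y ⊗ (Z ⊗ W)) ◁ f) f'.
Proof.
apply: heq_trans; apply: heq_tensm; last exact: heq_refl.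
by apply: heq_idm; rewrite tens_assoc.
Qed.

Lemma heq_lwhisker_unit (C : strict_monoidal) (Y A B A' B' : C)
    (f : hom A B) (f' : hom A' B') :
  heq (Y ◁ f) f' -> heq ((Y ⊗ unit_ob) ◁ f) f'.
Proof.
apply: heq_trans; apply: heq_tensm; last exact: heq_refl.
by apply: heq_idm; rewrite tens_unitr.
Qed.

Lemma heq_whisker_unit (C : strict_monoidal) (A B A' B' : C)
    (f : hom A B) (f' : hom A' B') :
  heq f f' -> heq (f ▷ unit_ob) f'.
Proof. apply: heq_trans; exact: heq_tensm_unitr. Qed.

Lemma heq_lwhisker_whisker (C : strict_monoidal) (Y Z A B A' B' : C)
    (f : hom A B) (f' : hom A' B') :
  heq ((Y ◁ f) ▷ Z) f' -> heq (Y ◁ (f ▷ Z)) f'.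
Proof. apply: heq_trans; apply: heq_sym; exact: heq_tensm_assoc. Qed.

Lemma heq_lwhisker_tensm (C : strict_monoidal)
    (Y A A1 B B1 A' B' D' : C) (f : hom A A1) (g : hom B B1)
    (f' : hom A' B') (g' : hom B' D') :
  heq (Y ◁ (f ▷ B)) f' -> heq (Y ◁ (A1 ◁ g)) g' ->
  heq (Y ◁ (f ⊗ₘ g)) (f' ;; g').
Proof.
by move=> ff' gg'; rewrite [f ⊗ₘ g]tensm_lr tensm_compl; apply: heq_comp.
Qed.

Lemma heq_tensm_lr (C : strict_monoidal)
    (A A1 B B1 A' B' D' : C) (f : hom A A1) (g : hom B B1)
    (f' : hom A' B') (g' : hom B' D') :
  heq (f ▷ B) f' -> heq (A1 ◁ g) g' -> heq (f ⊗ₘ g) (f' ;; g').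
Proof. by move=> ff' gg'; rewrite tensm_lr; apply: heq_comp. Qed.

(** * Slices *)

(* Objects are kept nested to the left, Y ⊗ H ⊗ H ⊗ ..., and each structure
   morphism of H is used as a family natural in the left factor Y. Whiskering on
   the left is then instantiation of Y, whiskering on the right is [▷], and no
   strictness equality between objects occurs in composites. *)
Section Slices.

Context {C : strict_braided} (H : whq_data C) (Y : C).

Definition eta_ : hom Y (Y ⊗ H) := retype (Y ◁ eta H).
Definition mu_ : hom (Y ⊗ H ⊗ H) (Y ⊗ H) := retype (Y ◁ mu H).
Definition eps_ : hom (Y ⊗ H) Y := retype (Y ◁ eps H).
Definition delta_ : hom (Y ⊗ H) (Y ⊗ H ⊗ H) := retype (Y ◁ delta H).
Definition braid_ : hom (Y ⊗ H ⊗ H) (Y ⊗ H ⊗ H) := retype (Y ◁ braid H H).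
Definition braidV_ : hom (Y ⊗ H ⊗ H) (Y ⊗ H ⊗ H) :=
  retype (Y ◁ braid_inv H H).
Definition act_on (A B : C) (f : hom A B) : hom (Y ⊗ A) (Y ⊗ B) := Y ◁ f.

Lemma heq_eta : heq (Y ◁ eta H) eta_.
Proof. apply: heq_sym; apply: heq_retype; exact: heq_refl. Qed.

Lemma heq_mu : heq (Y ◁ mu H) mu_.
Proof. apply: heq_sym; apply: heq_retype; exact: heq_refl. Qed.

Lemma heq_eps : heq (Y ◁ eps H) eps_.
Proof. apply: heq_sym; apply: heq_retype; exact: heq_refl. Qed.

Lemma heq_delta : heq (Y ◁ delta H) delta_.
Proof. apply: heq_sym; apply: heq_retype; exact: heq_refl. Qed.

Lemma heq_braid : heq (Y ◁ braid H H) braid_.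
Proof. apply: heq_sym; apply: heq_retype; exact: heq_refl. Qed.

Lemma heq_braidV : heq (Y ◁ braid_inv H H) braidV_.
Proof. apply: heq_sym; apply: heq_retype; exact: heq_refl. Qed.

End Slices.

Ltac heq_obj := rewrite ?tens_assoc ?tens_unitl ?tens_unitr; reflexivity.

(* Solves [heq f ?g], with ?g the composite of slices denoted by f. *)
Ltac slice :=
  lazymatch goal with
  | |- heq (retype _) _ => eapply heq_retype; slice
  | |- heq (scomp _ _) _ => eapply heq_scomp; [slice | slice]
  | |- heq (comp _ _) _ => eapply heq_comp; [slice | slice]
  | |- heq (tensm (idm _) (idm _)) _ =>
      eapply heq_lwhisker_id; first [exact eq_refl | heq_obj]
  | |- heq (tensm (idm (tens _ (tens _ _))) _) _ =>
      eapply heq_lwhisker_assoc; slice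
  | |- heq (tensm (idm (tens _ unit_ob)) _) _ =>
      eapply heq_lwhisker_unit; slice
  | |- heq (tensm (idm _) (eta _)) _ => apply heq_eta
  | |- heq (tensm (idm _) (mu _)) _ => apply heq_mu
  | |- heq (tensm (idm _) (eps _)) _ => apply heq_eps
  | |- heq (tensm (idm _) (delta _)) _ => apply heq_delta
  | |- heq (tensm (idm _) (braid _ _)) _ => apply heq_braid
  | |- heq (tensm (idm _) (braid_inv _ _)) _ => apply heq_braidV
  | |- heq (tensm (idm _) (retype _)) _ => eapply heq_lwhisker_retype; slice
  | |- heq (tensm (idm _) (scomp _ _)) _ =>
      eapply heq_lwhisker_scomp; [slice | slice]
  | |- heq (tensm (idm _) (comp _ _)) _ =>
      eapply heq_lwhisker_comp; [slice | slice]
  | |- heq (tensm (idm _) (tensm (idm _) _)) _ =>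
      eapply heq_lwhisker_lwhisker; slice
  | |- heq (tensm (idm _) (tensm _ (idm _))) _ =>
      eapply heq_lwhisker_whisker; slice
  | |- heq (tensm (idm _) (tensm _ _)) _ =>
      eapply heq_lwhisker_tensm; [slice | slice]
  | |- heq (tensm (idm ?Y) ?f) _ => exact (heq_refl (act_on Y f))
  | |- heq (tensm _ (idm unit_ob)) _ => eapply heq_whisker_unit; slice
  | |- heq (tensm _ (idm (tens _ _))) _ => eapply heq_whisker2; slice
  | |- heq (tensm _ (idm _)) _ => eapply heq_whisker; slice
  | |- heq (tensm _ _) _ => eapply heq_tensm_lr; [slice | slice]
  | |- heq (idm _) _ => eapply heq_idm; first [exact eq_refl | heq_obj]
  | |- heq _ _ => apply heq_refl
  end.

Local Notation "f ⁺" := (tensm f (idm _)) (at level 1, format "f ⁺").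
Local Notation "⟦ f ⟧" := (act_on _ f) (format "⟦ f ⟧").

(** The axioms of [H] enter here: an equation stated with casts becomes one between cast-free
    composites of slices. *)
Lemma heq_slices (C : category) (A B A1 B1 A2 B2 : C) (f : hom A1 B1)
    (g : hom A2 B2) (f' g' : hom A B) :
  heq f g -> heq f f' -> heq g g' -> f' = g'.
Proof.
move=> fg ff' gg'; apply: heq_eq; apply: heq_trans (heq_sym ff') _.
exact: heq_trans gg'.
Qed.

(** * Naturality in the left factor and the interchange law *)

Ltac norm := rewrite ?(comp_assoc, tensm_compr, tensm_id, comp_idl, comp_idr).
Ltac norm_in E :=
  rewrite ?(comp_assoc, tensm_compr, tensm_id, comp_idl, comp_idr) in E.

(** Asking for [kA] and [kB] only up to [heq] lets one proof serve all structure slices, whether [A]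
    and [B] are the unit, [H] or [H ⊗ H]. *)
Lemma retype_nat (C : strict_monoidal) (Y Y' A B A1 B1 A2 B2 : C)
  (f : hom A B) (k : hom Y Y') (kA : hom A1 A2) (kB : hom B1 B2)
  (eA : streq (Y ⊗ A) A1) (eB : streq (Y ⊗ B) B1)
  (eA' : streq (Y' ⊗ A) A2) (eB' : streq (Y' ⊗ B) B2) :
  heq kA (k ▷ A) -> heq kB (k ▷ B) ->
  retype (Y ◁ f) ;; kB = kA ;; retype (Y' ◁ f).
Proof.
move=> hA hB; apply: (heq_slices (eq_heq (whiskers_commute k f))).
  by apply: heq_comp; apply: heq_sym => //; apply: heq_retype; exact: heq_refl.
by apply: heq_comp; apply: heq_sym => //; apply: heq_retype; exact: heq_refl.
Qed.

Section Naturality.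

Context {C : strict_braided} (H : whq_data C) (Y Y' : C) (k : hom Y Y').

Lemma eta_nat : eta_ H Y ;; k⁺ = k ;; eta_ H Y'.
Proof.
apply: retype_nat; first exact: heq_sym (heq_tensm_unitr _); exact: heq_refl.
Qed.

Lemma mu_nat : mu_ H Y ;; k⁺ = k⁺⁺ ;; mu_ H Y'.
Proof.
apply: retype_nat; last exact: heq_refl.
apply: heq_sym; apply: heq_whisker2; exact: heq_refl.
Qed.

Lemma eps_nat : eps_ H Y ;; k = k⁺ ;; eps_ H Y'.
Proof.
apply: retype_nat; first exact: heq_refl; exact: heq_sym (heq_tensm_unitr _).
Qed.

Lemma delta_nat : delta_ H Y ;; k⁺⁺ = k⁺ ;; delta_ H Y'.
Proof.
apply: retype_nat; first exact: heq_refl.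
apply: heq_sym; apply: heq_whisker2; exact: heq_refl.
Qed.

Lemma slice_braid_nat : braid_ H Y ;; k⁺⁺ = k⁺⁺ ;; braid_ H Y'.
Proof.
by apply: retype_nat; apply: heq_sym; apply: heq_whisker2; exact: heq_refl.
Qed.

Lemma braidV_nat : braidV_ H Y ;; k⁺⁺ = k⁺⁺ ;; braidV_ H Y'.
Proof.
by apply: retype_nat; apply: heq_sym; apply: heq_whisker2; exact: heq_refl.
Qed.

Lemma act_on_nat (A B : C) (f : hom A B) :
  act_on Y f ;; k⁺ = k⁺ ;; act_on Y' f.
Proof. exact: whiskers_commute. Qed.

End Naturality.

Section Interchange.

Context {C : strict_monoidal}.

Lemma whisker_slide (A B B' D P : C) (f : hom A B) (g : hom B D)
    (g' : hom A B') (f' : hom B' D) :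
  f ;; g = g' ;; f' -> f ▷ P ;; g ▷ P = g' ▷ P ;; f' ▷ P.
Proof. by rewrite -!tensm_compr => ->. Qed.

Lemma slide_head (A B B' D E : C) (f : hom A B) (g : hom B D)
    (g' : hom A B') (f' : hom B' D) (r : hom D E) :
  f ;; g = g' ;; f' -> f ;; g ;; r = g' ;; f' ;; r.
Proof. by rewrite -!comp_assoc => ->. Qed.

Lemma slide_tail (A B D : C) (f : hom A B) (r r' : hom B D) :
  r = r' -> f ;; r = f ;; r'.
Proof. by move->. Qed.

End Interchange.

(* Interchange is naturality in the left factor: every slice is moved past the
   slices located entirely to its right. For the connected diagrams met below
   this terminates in a normal form for planar isotopy. *)
Ltac slide :=
  lazymatch goal with
  | |- comp (tensm _ (idm _)) (eta_ _ _) = _ => eapply eta_nat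
  | |- comp _ (eps_ _ _) = _ => eapply eps_nat
  | |- comp (tensm _ (idm _)) (mu_ _ _) = _ => eapply mu_nat
  | |- comp (tensm (tensm _ (idm _)) (idm _)) (delta_ _ _) = _ =>
      eapply delta_nat
  | |- comp (tensm (tensm _ (idm _)) (idm _)) (braid_ _ _) = _ =>
      eapply slice_braid_nat
  | |- comp (tensm (tensm _ (idm _)) (idm _)) (braidV_ _ _) = _ =>
      eapply braidV_nat
  | |- comp (tensm _ (idm _)) (act_on _ _) = _ => eapply act_on_nat
  | |- comp (tensm _ (idm _)) (tensm _ (idm _)) = _ =>
      eapply whisker_slide; slide
  end.

Ltac bubble :=
  lazymatch goal with
  | |- comp (comp _ _) _ = _ =>
      first [ eapply slide_head; slide | eapply slide_tail; bubble ]
  | _ => slide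
  end.

Ltac sink := repeat (eapply eq_trans; [bubble |]).

Ltac interchange :=
  norm; sink; symmetry; sink; reflexivity.

(** * The braiding against the unit object and against tensor products *)

Section UnitBraid.

Context {C : strict_braided}.

Lemma heq_braid_eqr (A B B' : C) : B = B' -> heq (braid A B) (braid A B').
Proof. move=> ->; exact: heq_refl. Qed.

Lemma heq_braid_eql (A B B' : C) : B = B' -> heq (braid B A) (braid B' A).
Proof. move=> ->; exact: heq_refl. Qed.

Lemma idempotent_mono_id (A : C) (b v : hom A A) :
  b ;; b = b -> b ;; v = idm A -> b = idm A.
Proof. by move=> bb bv; rewrite -bv -{2}bb comp_assoc bv comp_idl. Qed.

(** The hexagon [braid_tensr] at [unit_ob] makes this braiding idempotent, and an invertible
    idempotent is an identity. *)
Lemma heq_braid_unitr (A : C) : heq (braid A unit_ob) (idm A).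
Proof.
pose (b := retype (braid A unit_ob) : hom A A).
pose (v := retype (braid_inv A unit_ob) : hom A A).
have hb : heq (braid A unit_ob) b.
  by apply: heq_sym; apply: heq_retype; exact: heq_refl.
have hv : heq (braid_inv A unit_ob) v.
  by apply: heq_sym; apply: heq_retype; exact: heq_refl.
suff <- : b = idm A by [].
apply: (@idempotent_mono_id A b v).
  symmetry; apply: (heq_slices (eqm_heq (braid_tensr A unit_ob unit_ob))).
    by apply: heq_trans hb; apply: heq_braid_eqr; rewrite tens_unitl.
  apply: heq_scomp.
    by apply: heq_trans hb; exact: heq_tensm_unitr.
  by apply: heq_trans hb; exact: heq_tensm_unitl.
apply: (heq_slices (eq_heq (braidK A unit_ob))).
  exact: heq_scomp.
by apply: heq_idm; rewrite tens_unitr.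
Qed.

Lemma heq_braid_unitl (A : C) : heq (braid unit_ob A) (idm A).
Proof.
pose (b := retype (braid unit_ob A) : hom A A).
pose (v := retype (braid_inv unit_ob A) : hom A A).
have hb : heq (braid unit_ob A) b.
  by apply: heq_sym; apply: heq_retype; exact: heq_refl.
have hv : heq (braid_inv unit_ob A) v.
  by apply: heq_sym; apply: heq_retype; exact: heq_refl.
suff <- : b = idm A by [].
apply: (@idempotent_mono_id A b v).
  symmetry; apply: (heq_slices (eqm_heq (braid_tensl unit_ob unit_ob A))).
    by apply: heq_trans hb; apply: heq_braid_eql; rewrite tens_unitl.
  apply: heq_scomp.
    by apply: heq_trans hb; exact: heq_tensm_unitl.
  by apply: heq_trans hb; exact: heq_tensm_unitr.
apply: (heq_slices (eq_heq (braidK unit_ob A))).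
  exact: heq_scomp.
by apply: heq_idm; rewrite tens_unitl.
Qed.

Lemma braid_nat_r (A B B1 B2 : C) (f : hom B (B1 ⊗ B2)) :
  heq ((B1 ◁ braid A B2) ∘ (braid A B1 ▷ B2) ∘ (A ◁ f))
      ((f ▷ A) ∘ braid A B).
Proof.
apply: heq_trans (eq_heq (braid_nat (idm A) f)).
apply: heq_scomp; first exact: heq_refl.
apply: heq_sym; exact: (eqm_heq (braid_tensr _ _ _)).
Qed.

Lemma braid_nat_l (A A1 A2 B : C) (f : hom A (A1 ⊗ A2)) :
  heq ((braid A1 B ▷ A2) ∘ (A1 ◁ braid A2 B) ∘ (f ▷ B))
      ((B ◁ f) ∘ braid A B).
Proof.
apply: heq_trans (eq_heq (braid_nat f (idm B))).
apply: heq_scomp; first exact: heq_refl.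
apply: heq_sym; exact: (eqm_heq (braid_tensl _ _ _)).
Qed.

Lemma braid_conat_r (A B B1 B2 : C) (f : hom (B1 ⊗ B2) B) :
  heq ((f ▷ A) ∘ ((B1 ◁ braid A B2) ∘ (braid A B1 ▷ B2)))
      (braid A B ∘ (A ◁ f)).
Proof.
apply: heq_trans (eq_heq (eq_sym (braid_nat (idm A) f))).
apply: heq_scomp; last exact: heq_refl.
apply: heq_sym; exact: (eqm_heq (braid_tensr _ _ _)).
Qed.

Lemma braid_conat_l (A A1 A2 B : C) (f : hom (A1 ⊗ A2) A) :
  heq ((B ◁ f) ∘ ((braid A1 B ▷ A2) ∘ (A1 ◁ braid A2 B)))
      (braid A B ∘ (f ▷ B)).
Proof.
apply: heq_trans (eq_heq (eq_sym (braid_nat f (idm B)))).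
apply: heq_scomp; last exact: heq_refl.
apply: heq_sym; exact: (eqm_heq (braid_tensl _ _ _)).
Qed.

Lemma braid_point_r (A B : C) (f : hom unit_ob B) :
  heq (braid A B ∘ (A ◁ f)) (f ▷ A).
Proof.
apply: heq_trans (eq_heq (braid_nat (idm A) f)) _.
rewrite -[X in heq _ X]comp_idr.
apply: heq_scomp; last exact: heq_refl.
apply: heq_trans (heq_braid_unitr A) _; apply: heq_idm.
by rewrite tens_unitl.
Qed.

Lemma braid_point_l (A B : C) (f : hom unit_ob B) :
  heq (braid B A ∘ (f ▷ A)) (A ◁ f).
Proof.
apply: heq_trans (eq_heq (braid_nat f (idm A))) _.
rewrite -[X in heq _ X]comp_idr.
apply: heq_scomp; last exact: heq_refl.
apply: heq_trans (heq_braid_unitl A) _; apply: heq_idm.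
by rewrite tens_unitr.
Qed.

Lemma braid_copoint_r (A B : C) (f : hom B unit_ob) :
  heq ((f ▷ A) ∘ braid A B) (A ◁ f).
Proof.
apply: heq_trans (eq_heq (eq_sym (braid_nat (idm A) f))) _.
rewrite -[X in heq _ X]comp_idl.
apply: heq_scomp; first exact: heq_refl.
apply: heq_trans (heq_braid_unitr A) _; apply: heq_idm.
by rewrite tens_unitr.
Qed.

End UnitBraid.

Ltac slices_of E :=
  let F := fresh "F" in
  eassert (F := heq_slices E ltac:(slice) ltac:(slice));
  norm_in F; move: F.

Ltac slices_goal :=
  lazymatch goal with |- eqm _ _ => apply: heq_eqm | _ => apply: heq_eq end;
  eapply heq_trans; [slice |];
  eapply heq_trans; [| eapply heq_sym; slice];
  apply: eq_heq; norm.

(** * The structure morphisms of [H] against the braiding *)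

Section BraidSlices.

Context {C : strict_braided} (H : whq_data C) (Y : C).

Local Notation "'δ'" := (delta_ H _).
Local Notation "'μ'" := (mu_ H _).
Local Notation "'ε'" := (eps_ H _).
Local Notation "'η'" := (eta_ H _).
Local Notation "'χ'" := (braid_ H _).
Local Notation "'ξ'" := (braidV_ H _).

Lemma braidK_ : χ ;; ξ = idm (Y ⊗ H ⊗ H).
Proof.
have E := heq_lwhisker Y (eq_heq (braidK H H)).
by slices_of E.
Qed.

Lemma braidVK_ : ξ ;; χ = idm (Y ⊗ H ⊗ H).
Proof.
have E := heq_lwhisker Y (eq_heq (braidVK H H)).
by slices_of E.
Qed.

Lemma delta_braid_r : (δ : hom (Y ⊗ H ⊗ H) _) ;; χ⁺ ;; χ = χ ;; δ⁺.
Proof.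
have E := heq_lwhisker Y (braid_nat_r H (delta H)).
by slices_of E.
Qed.

Lemma delta_braid_l : (δ⁺ : hom (Y ⊗ H ⊗ H) _) ;; χ ;; χ⁺ = χ ;; δ.
Proof.
have E := heq_lwhisker Y (braid_nat_l H (delta H)).
by slices_of E.
Qed.

Lemma mu_braid_r : (χ⁺ : hom (Y ⊗ H ⊗ H ⊗ H) _) ;; χ ;; μ⁺ = μ ;; χ.
Proof.
have E := heq_lwhisker Y (braid_conat_r H (mu H)).
by slices_of E.
Qed.

Lemma mu_braid_l : (χ : hom (Y ⊗ H ⊗ H ⊗ H) _) ;; χ⁺ ;; μ = μ⁺ ;; χ.
Proof.
have E := heq_lwhisker Y (braid_conat_l H (mu H)).
by slices_of E.
Qed.

Lemma eta_braid_r : (η : hom (Y ⊗ H) _) ;; χ = η⁺.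
Proof.
have E := heq_lwhisker Y (braid_point_r H (eta H)).
by slices_of E.
Qed.

Lemma eta_braid_l : (η⁺ : hom (Y ⊗ H) _) ;; χ = η.
Proof.
have E := heq_lwhisker Y (braid_point_l H (eta H)).
by slices_of E.
Qed.

Lemma eps_braid_r : χ ;; ε⁺ = (ε : hom (Y ⊗ H ⊗ H) _).
Proof.
have E := heq_lwhisker Y (braid_copoint_r H (eps H)).
by slices_of E.
Qed.

End BraidSlices.

(** * Epimorphisms *)

Definition epi (C : category) (A B : C) (f : hom A B) : Prop :=
  forall (D : C) (g h : hom B D), f ;; g = f ;; h -> g = h.

Lemma coequalizer_epi (C : category) (A B Q : C) (f g : hom A B) (n : hom B Q) :
  is_coequalizer f g n -> epi n.
Proof.
case=> fg_n univ D a b ab.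
have [] := univ D (n ;; a); first by rewrite -!comp_assoc fg_n.
by move=> k [_ uniq]; rewrite -(uniq a) // -(uniq b).
Qed.

Lemma split_epi (C : category) (A B : C) (f : hom A B) (g : hom B A) :
  g ;; f = idm B -> epi f.
Proof.
move=> gf D a b ab.
by rewrite -(comp_idr a) -(comp_idr b) -gf !comp_assoc ab.
Qed.

(** * Identities in a weak Hopf quasigroup *)

Section WeakHopfQuasigroup.

Context {C : strict_braided} (H : weak_hopf_quasigroup C).

Local Notation "'δ'" := (delta_ H _).
Local Notation "'μ'" := (mu_ H _).
Local Notation "'ε'" := (eps_ H _).
Local Notation "'η'" := (eta_ H _).
Local Notation "'χ'" := (braid_ H _).
Local Notation "'ξ'" := (braidV_ H _).
Local Notation "'λ'" := (act_on _ (lambda H)).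
Local Notation "'ΠL'" := (act_on _ (PiL H)).
Local Notation "'ΠR'" := (act_on _ (PiR H)).

Section SliceAxioms.

Variable Y : C.

Lemma mul_unit_r : (η : hom (Y ⊗ H) _) ;; μ = idm _.
Proof.
by slices_of (heq_lwhisker Y
  (eqm_heq (proj1 (whq_magma (whq_axioms H))))).
Qed.

Lemma mul_unit_l : (η⁺ : hom (Y ⊗ H) _) ;; μ = idm _.
Proof.
by slices_of (heq_lwhisker Y
  (eqm_heq (proj2 (whq_magma (whq_axioms H))))).
Qed.

Lemma delta_counit_r : (δ : hom (Y ⊗ H) _) ;; ε = idm _.
Proof.
by slices_of (heq_lwhisker Y
  (eqm_heq (proj1 (whq_comonoid (whq_axioms H))))).
Qed.

Lemma delta_counit_l : (δ : hom (Y ⊗ H) _) ;; ε⁺ = idm _.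
Proof.
by slices_of (heq_lwhisker Y
  (eqm_heq (proj1 (proj2 (whq_comonoid (whq_axioms H)))))).
Qed.

Lemma coassoc : (δ : hom (Y ⊗ H) _) ;; δ⁺ = δ ;; δ.
Proof.
by slices_of (heq_lwhisker Y
  (eqm_heq (proj2 (proj2 (whq_comonoid (whq_axioms H)))))).
Qed.

Lemma delta_mul :
  (μ : hom (Y ⊗ H ⊗ H) _) ;; δ = δ⁺ ;; δ ;; χ⁺ ;; μ⁺⁺ ;; μ.
Proof.
have E := eq_heq (whq_a1 (whq_axioms H)); rewrite /delta2 in E.
by slices_of (heq_lwhisker Y E).
Qed.

Lemma eps_mul_assoc :
  (μ⁺ : hom (Y ⊗ H ⊗ H ⊗ H) _) ;; μ ;; ε = μ ;; μ ;; ε.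
Proof. by slices_of (heq_lwhisker Y (eqm_heq (whq_a2_1 (whq_axioms H)))). Qed.

Lemma eps_mul_delta :
  (μ : hom (Y ⊗ H ⊗ H ⊗ H) _) ;; μ ;; ε = δ⁺ ;; μ⁺⁺ ;; ε⁺⁺ ;; μ ;; ε.
Proof. by slices_of (heq_lwhisker Y (eqm_heq (whq_a2_2 (whq_axioms H)))). Qed.

Lemma delta_unit : (η : hom Y _) ;; δ ;; δ⁺ = η ;; δ ;; η ;; δ ;; μ⁺.
Proof. by slices_of (heq_lwhisker Y (eqm_heq (whq_a3_1 (whq_axioms H)))). Qed.

Lemma delta_unit_braidV :
  (η : hom Y _) ;; δ ;; η ;; δ ;; μ⁺ = η ;; δ ;; η ;; δ ;; ξ⁺ ;; μ⁺.
Proof. by slices_of (heq_lwhisker Y (eqm_heq (whq_a3_2 (whq_axioms H)))). Qed.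

Lemma PiL_eps :
  (ΠL : hom (Y ⊗ H) _) = η⁺ ;; δ⁺ ;; χ ;; μ⁺ ;; ε⁺.
Proof. by slices_of (heq_lwhisker Y (eqm_heq (whq_a4_1 (whq_axioms H)))). Qed.

Lemma PiR_eps :
  (ΠR : hom (Y ⊗ H) _) = η ;; δ ;; χ⁺ ;; μ ;; ε.
Proof. by slices_of (heq_lwhisker Y (eqm_heq (whq_a4_2 (whq_axioms H)))). Qed.

Lemma PiL_antipode : δ ;; λ ;; μ = (ΠL : hom (Y ⊗ H) _).
Proof.
have E := eq_heq (eq_refl : mu H ∘ (H ◁ lambda H) ∘ delta H = PiL H).
by slices_of (heq_lwhisker Y E).
Qed.

Lemma antipode_mul :
  (δ⁺ : hom (Y ⊗ H ⊗ H) _) ;; λ⁺⁺ ;; μ ;; μ = ΠR⁺ ;; μ.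
Proof. by slices_of (heq_lwhisker Y (eqm_heq (whq_a4_4 (whq_axioms H)))). Qed.

Lemma mul_antipode_r :
  (δ : hom (Y ⊗ H ⊗ H) _) ;; μ⁺ ;; λ ;; μ = ΠL ;; μ.
Proof. by slices_of (heq_lwhisker Y (eqm_heq (whq_a4_6 (whq_axioms H)))). Qed.

Lemma mul_antipode_l :
  (δ : hom (Y ⊗ H ⊗ H) _) ;; λ⁺ ;; μ⁺ ;; μ = ΠR ;; μ.
Proof. by slices_of (heq_lwhisker Y (eqm_heq (whq_a4_7 (whq_axioms H)))). Qed.

End SliceAxioms.

Lemma delta_delta_unit (Y : C) :
  (η : hom Y _) ;; δ ;; δ = η ;; δ ;; η ;; δ ;; μ⁺.
Proof. by rewrite -delta_unit coassoc. Qed.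

Lemma act_on_braid (Y : C) (f : hom H H) :
  ⟦f⟧⁺ ;; χ = (χ : hom (Y ⊗ H ⊗ H) _) ;; ⟦f⟧.
Proof.
by slices_of (heq_lwhisker Y (eq_heq (braid_nat f (idm H)))).
Qed.

(* a -> eps(a 1_1) 1_2. It fixes H_L, and unlike PiL its definition involves no
   braiding. *)
Definition PbarR : hom H H :=
  retype (((eps H ∘ mu H) ▷ H) ∘ (H ◁ (delta H ∘ eta H))).

Local Notation "'Π'" := (act_on _ PbarR).

Lemma PbarR_eps (Y : C) : (Π : hom (Y ⊗ H) _) = η ;; δ ;; μ⁺ ;; ε⁺.
Proof.
have E : heq PbarR (((eps H ∘ mu H) ▷ H) ∘ (H ◁ (delta H ∘ eta H))).
  by apply: heq_retype; exact: heq_refl.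
by slices_of (heq_lwhisker Y E).
Qed.

(** The counit is applied to the first leg of [delta_mul]. Expanding a product this way puts a copy
    of it under [eps], where [eps_mul_assoc] reassociates although [mu] need not be associative. *)
Lemma eps_delta_mul (Y : C) :
  δ⁺ ;; δ ;; χ⁺ ;; μ⁺⁺ ;; ε⁺⁺ ;; μ = (μ : hom (Y ⊗ H ⊗ H) _).
Proof.
transitivity ((δ⁺ ;; δ ;; χ⁺ ;; μ⁺⁺ ;; μ) ;; ε⁺ : hom (Y ⊗ H ⊗ H) _).
  interchange.
by rewrite -delta_mul comp_assoc delta_counit_l comp_idl.
Qed.

Lemma eps_delta_mul' (Y : C) :
  δ⁺ ;; δ ;; χ⁺ ;; (μ;; ε)⁺⁺ ;; μ = (μ : hom (Y ⊗ H ⊗ H) _).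
Proof. by rewrite -[RHS]eps_delta_mul; interchange. Qed.

(* PbarR(a) b = eps(a b_1) b_2 *)
Lemma PbarR_mul (Y : C) :
  Π⁺ ;; μ = (δ : hom (Y ⊗ H ⊗ H) _) ;; μ⁺ ;; ε⁺.
Proof.
symmetry.
(* Writing b as 1 b gives eps(a (1_1 b_1)) 1_2 b_2, which [eps_mul_delta] splits into eps(a 1_1)
   eps(1_2 b_1) 1_3 b_2; the last two factors contract to 1_2 b. *)
transitivity ((η⁺ ;; μ) ;; δ ;; μ⁺ ;; ε⁺ : hom (Y ⊗ H ⊗ H) _).
  by rewrite mul_unit_l comp_idr.
transitivity (η⁺ ;; (μ ;; δ) ;; μ⁺ ;; ε⁺ : hom (Y ⊗ H ⊗ H) _).
  by norm.
rewrite delta_mul.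
transitivity (η⁺ ;; δ⁺ ;; δ ;; χ⁺ ;; (μ ;; μ ;; ε)⁺⁺ ;; μ
    : hom (Y ⊗ H ⊗ H) _); first by interchange.
rewrite eps_mul_delta.
transitivity ((η ;; δ ;; δ⁺)⁺ ;; μ⁺⁺⁺ ;; ε⁺⁺⁺ ;; δ ;; χ⁺ ;; (μ ;; ε)⁺⁺ ;; μ
    : hom (Y ⊗ H ⊗ H) _); first by interchange.
rewrite coassoc.
transitivity ((η ;; δ ;; μ⁺ ;; ε⁺)⁺ ;; (δ⁺ ;; δ ;; χ⁺ ;; (μ ;; ε)⁺⁺ ;; μ)
    : hom (Y ⊗ H ⊗ H) _); first by interchange.
by rewrite -PbarR_eps eps_delta_mul'.
Qed.

(** With 1' a second unit, PbarR(1_2) = eps(1_2 1'_1) 1'_2, and 1_1 ⊗ 1_2 1'_1 ⊗ 1'_2 is the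
    iterated coproduct of 1, whose middle leg the counit removes. *)
Lemma delta_unit_PbarR (Y : C) : (η : hom Y _) ;; δ ;; Π = η ;; δ.
Proof.
rewrite PbarR_eps.
transitivity ((η ;; δ ;; η ;; δ ;; μ⁺) ;; ε⁺ : hom Y _); first by interchange.
rewrite -delta_delta_unit.
transitivity (η ;; δ ;; (δ ;; ε⁺) : hom Y _); first by norm.
by rewrite delta_counit_l comp_idl.
Qed.

(** * The coproduct of the unit, the target morphism and partial associativity *)

Lemma unit_braid_r (Y : C) :
  η ;; δ ;; χ⁺ ;; χ = η⁺ ;; (δ⁺ : hom (Y ⊗ H ⊗ H) _).
Proof.
transitivity (η ;; (δ ;; χ⁺ ;; χ) : hom (Y ⊗ H) _); first by norm.
by rewrite delta_braid_r -comp_assoc eta_braid_r.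
Qed.

Lemma unit_braid_l (Y : C) :
  η⁺ ;; δ⁺ ;; χ ;; χ⁺ = η ;; (δ : hom (Y ⊗ H ⊗ H) _).
Proof.
transitivity (η⁺ ;; (δ⁺ ;; χ ;; χ⁺) : hom (Y ⊗ H) _); first by norm.
by rewrite delta_braid_l -comp_assoc eta_braid_l.
Qed.

Lemma unit_braidV_r (Y : C) :
  η ;; δ ;; ξ⁺ = η⁺ ;; δ⁺ ;; (χ : hom (Y ⊗ H ⊗ H ⊗ H) _).
Proof.
transitivity ((η⁺ ;; δ⁺ ;; χ ;; χ⁺) ;; ξ⁺ : hom (Y ⊗ H) _).
  by rewrite unit_braid_l; norm.
transitivity (η⁺ ;; δ⁺ ;; χ ;; (χ ;; ξ)⁺ : hom (Y ⊗ H) _); first by norm.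
by rewrite braidK_ tensm_id comp_idl.
Qed.

Lemma unit_braidV_braidV (Y : C) :
  η ;; δ ;; ξ⁺ ;; ξ = η⁺ ;; (δ⁺ : hom (Y ⊗ H ⊗ H) _).
Proof.
transitivity ((η ;; δ ;; ξ⁺) ;; ξ : hom (Y ⊗ H) _); first by norm.
by rewrite unit_braidV_r !comp_assoc braidK_ comp_idl.
Qed.

(** In this form the second leg of the coproduct of 1 reaches the output untouched, so identities
    for 1_2 carry over to [PiL]. *)
Lemma PiL_braidV (Y : C) :
  (ΠL : hom (Y ⊗ H) _) = η ;; δ ;; ξ⁺ ;; μ⁺ ;; ε⁺.
Proof.
rewrite PiL_eps.
transitivity ((η⁺ ;; δ⁺ ;; χ) ;; μ⁺ ;; ε⁺ : hom (Y ⊗ H) _); first by norm.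
by rewrite -unit_braidV_r; norm.
Qed.

Lemma PiL_PbarR (Y : C) : ΠL ;; Π = (ΠL : hom (Y ⊗ H) _).
Proof.
rewrite PiL_braidV.
transitivity ((η ;; δ ;; Π) ;; ξ⁺ ;; μ⁺ ;; ε⁺ : hom (Y ⊗ H) _).
  by interchange.
by rewrite delta_unit_PbarR; norm.
Qed.

(** By coassociativity the last leg is still the last leg of the coproduct of 1, which [PbarR]
    fixes. *)
Lemma PiL_delta_PbarR (Y : C) : ΠL ;; δ ;; Π = (ΠL : hom (Y ⊗ H) _) ;; δ.
Proof.
rewrite PiL_braidV.
transitivity ((η ;; (δ ;; δ) ;; Π) ;; ξ⁺⁺ ;; μ⁺⁺ ;; ε⁺⁺ : hom (Y ⊗ H) _).
  by interchange.
rewrite -coassoc.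
transitivity ((η ;; δ ;; Π) ;; δ⁺ ;; ξ⁺⁺ ;; μ⁺⁺ ;; ε⁺⁺ : hom (Y ⊗ H) _).
  by interchange.
rewrite delta_unit_PbarR.
transitivity (η ;; (δ ;; δ⁺) ;; ξ⁺⁺ ;; μ⁺⁺ ;; ε⁺⁺ : hom (Y ⊗ H) _).
  by interchange.
by rewrite coassoc; interchange.
Qed.

(** By [PiL_eps] the left side is eps(1_1 h_1) 1_2 h_2, which contracts to 1 h. *)
Lemma PiL_id (Y : C) : δ ;; ΠL⁺ ;; μ = idm (Y ⊗ H).
Proof.
rewrite PiL_eps.
transitivity (η⁺ ;; (δ⁺ ;; δ ;; χ⁺ ;; μ⁺⁺ ;; ε⁺⁺ ;; μ) : hom (Y ⊗ H) _).
  by interchange.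
by rewrite eps_delta_mul mul_unit_l.
Qed.

(** By [PbarR_mul] and coassociativity both sides are eps(a b_1) b_2 ⊗ b_3. *)
Lemma PbarR_delta (Y : C) :
  Π⁺ ;; μ ;; δ = Π⁺ ;; δ ;; (μ⁺ : hom (Y ⊗ H ⊗ H ⊗ H) _).
Proof.
transitivity ((Π⁺ ;; μ) ;; δ : hom (Y ⊗ H ⊗ H) _); first by norm.
rewrite PbarR_mul.
transitivity ((δ ;; δ) ;; μ⁺⁺ ;; ε⁺⁺ : hom (Y ⊗ H ⊗ H) _).
  by interchange.
rewrite -coassoc.
transitivity (δ ;; (δ ;; μ⁺ ;; ε⁺)⁺ : hom (Y ⊗ H ⊗ H) _); first by norm.
by rewrite -PbarR_mul; interchange.
Qed.

(** For z = PbarR(a) the coproduct of z b is z b_1 ⊗ b_2, so (z b) c expands to eps((z b_1) c_1) b_2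
    c_2. Reassociating under [eps] gives eps(z (b c)_1) (b c)_2, which is z (b c). *)
Lemma PbarR_mul_assoc (Y : C) :
  Π⁺⁺ ;; μ⁺ ;; μ = Π⁺⁺ ;; μ ;; (μ : hom (Y ⊗ H ⊗ H) _).
Proof.
transitivity (Π⁺⁺ ;; μ⁺ ;; (δ⁺ ;; δ ;; χ⁺ ;; μ⁺⁺ ;; ε⁺⁺ ;; μ)
    : hom (Y ⊗ H ⊗ H ⊗ H) _); first by rewrite eps_delta_mul.
transitivity ((Π⁺ ;; μ ;; δ)⁺ ;; δ ;; χ⁺ ;; μ⁺⁺ ;; ε⁺⁺ ;; μ
    : hom (Y ⊗ H ⊗ H ⊗ H) _); first by norm.
rewrite PbarR_delta.
transitivity (Π⁺⁺ ;; δ⁺ ;; δ ;; χ⁺ ;; (μ⁺ ;; μ ;; ε)⁺⁺ ;; μ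
    : hom (Y ⊗ H ⊗ H ⊗ H) _); first by interchange.
rewrite eps_mul_assoc.
transitivity (Π⁺⁺ ;; (δ⁺ ;; δ ;; χ⁺ ;; μ⁺⁺ ;; μ) ;; μ⁺ ;; ε⁺
    : hom (Y ⊗ H ⊗ H ⊗ H) _); first by interchange.
rewrite -delta_mul.
transitivity (μ ;; (Π⁺ ;; δ ;; μ⁺) ;; ε⁺
    : hom (Y ⊗ H ⊗ H ⊗ H) _); first by interchange.
rewrite -PbarR_delta.
transitivity (μ ;; Π⁺ ;; μ ;; (δ ;; ε⁺)
    : hom (Y ⊗ H ⊗ H ⊗ H) _); first by interchange.
by rewrite delta_counit_l comp_idl; interchange.
Qed.

Lemma braid_mul_braidV (Y : C) :
  χ⁺ ;; μ = ξ ;; μ⁺ ;; (χ : hom (Y ⊗ H ⊗ H) _).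
Proof.
rewrite -mu_braid_l.
transitivity ((ξ ;; χ) ;; χ⁺ ;; μ : hom (Y ⊗ H ⊗ H ⊗ H) _).
  by rewrite braidVK_ comp_idr.
by norm.
Qed.

(* 1_1 ⊗ h 1_2 = PiR(h_1) ⊗ h_2 *)
Lemma unit_mul_PiR (Y : C) :
  (η : hom (Y ⊗ H) _) ;; δ ;; χ⁺ ;; μ = δ ;; ΠR⁺.
Proof.
transitivity (η ;; δ ;; χ⁺ ;; (δ⁺ ;; δ ;; χ⁺ ;; μ⁺⁺ ;; ε⁺⁺ ;; μ)
    : hom (Y ⊗ H) _); first by rewrite eps_delta_mul.
transitivity ((η ;; δ ;; δ) ;; χ⁺⁺ ;; δ⁺⁺ ;; χ⁺ ;; μ⁺⁺ ;; ε⁺⁺ ;; μ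
    : hom (Y ⊗ H) _); first by interchange.
(* The opposite-order form of the unit axiom gives 1_1 ⊗ eps(h_1 (1'_1 1_2)) h_2 1'_2. Reassociation
   brings h_1 next to 1'_1, and h_1 1'_1 ⊗ h_2 1'_2 is the coproduct of h 1' = h. *)
rewrite delta_delta_unit delta_unit_braidV.
transitivity (η ;; δ ;; η ;; δ ;; ξ⁺ ;; χ⁺⁺⁺ ;; δ⁺⁺⁺ ;; (μ ;; χ)⁺ ;;
    μ⁺⁺ ;; ε⁺⁺ ;; μ : hom (Y ⊗ H) _); first by interchange.
rewrite -mu_braid_r.
transitivity (η ;; δ ;; χ⁺ ;; δ⁺ ;; η ;; δ ;; ξ⁺ ;; χ⁺⁺ ;; χ⁺ ;;
    (μ ;; μ ;; ε)⁺⁺ ;; μ : hom (Y ⊗ H) _); first by interchange.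
rewrite -eps_mul_assoc.
transitivity (η ;; δ ;; χ⁺ ;; δ⁺ ;; η ;; δ ;; ξ⁺ ;; χ⁺⁺ ;; μ⁺⁺⁺ ;;
    (χ⁺ ;; μ) ;; μ⁺ ;; ε⁺ : hom (Y ⊗ H) _); first by interchange.
rewrite braid_mul_braidV.
transitivity (η ;; δ ;; χ⁺ ;; δ⁺ ;; (η ;; δ ;; ξ⁺ ;; ξ) ;; χ⁺⁺ ;; μ⁺⁺⁺ ;;
    μ⁺ ;; χ ;; μ⁺ ;; ε⁺ : hom (Y ⊗ H) _); first by interchange.
rewrite unit_braidV_braidV.
transitivity (η ;; δ ;; χ⁺ ;; (η ;; (δ⁺ ;; δ ;; χ⁺ ;; μ⁺⁺ ;; μ))⁺ ;; χ ;;
    μ⁺ ;; ε⁺ : hom (Y ⊗ H) _); first by interchange.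
rewrite -delta_mul -!(comp_assoc δ μ η).
transitivity (η ;; δ ;; χ⁺ ;; ((η ;; μ) ;; δ)⁺ ;; χ ;;
    μ⁺ ;; ε⁺ : hom (Y ⊗ H) _); first by interchange.
rewrite mul_unit_r.
transitivity (η ;; δ ;; (χ ;; δ)⁺ ;; χ ;;
    μ⁺ ;; ε⁺ : hom (Y ⊗ H) _); first by interchange.
rewrite -delta_braid_l.
transitivity (δ ;; (η ;; δ ;; χ⁺ ;; χ) ;; χ⁺⁺ ;; μ⁺ ;; ε⁺
    : hom (Y ⊗ H) _); first by interchange.
rewrite unit_braid_r.
transitivity (δ ;; (η ;; δ ;; χ⁺ ;; μ ;; ε)⁺ : hom (Y ⊗ H) _).
  by interchange.
by rewrite -PiR_eps.
Qed.

(** By [unit_mul_PiR] both sides are PiR(h_1) ⊗ h_2 ⊗ h_3. *)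
Lemma unit_mul_delta (Y : C) :
  (η : hom (Y ⊗ H) _) ;; δ ;; χ⁺ ;; μ ;; δ = δ ;; (η ;; δ ;; χ⁺ ;; μ)⁺.
Proof.
transitivity ((η ;; δ ;; χ⁺ ;; μ) ;; δ : hom (Y ⊗ H) _); first by norm.
rewrite unit_mul_PiR.
transitivity ((δ ;; δ) ;; ΠR⁺⁺ : hom (Y ⊗ H) _); first by interchange.
by rewrite -coassoc; norm.
Qed.

(* 1_1 ⊗ (h 1_2) l = 1_1 ⊗ h (1_2 l) *)
Lemma unit_mul_assoc (Y : C) :
  η⁺ ;; δ⁺ ;; χ⁺⁺ ;; μ⁺ ;; μ =
  (η⁺ : hom (Y ⊗ H ⊗ H) _) ;; δ⁺ ;; χ⁺⁺ ;; μ ;; μ.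
Proof.
(* With 1_1 carried along, this side becomes eps((h_1 1_2) l_1) h_2 l_2, hence eps(h_1 (1_2 l_1))
   h_2 l_2; the other side is brought to the same form. *)
transitivity ((η ;; δ ;; χ⁺ ;; μ)⁺ ;; (δ⁺ ;; δ ;; χ⁺ ;; μ⁺⁺ ;; ε⁺⁺ ;; μ)
    : hom (Y ⊗ H ⊗ H) _); first by rewrite eps_delta_mul; norm.
transitivity ((η ;; δ ;; χ⁺ ;; μ ;; δ)⁺ ;; δ ;; χ⁺ ;; μ⁺⁺ ;; ε⁺⁺ ;; μ
    : hom (Y ⊗ H ⊗ H) _); first by norm.
rewrite unit_mul_delta.
transitivity (δ⁺ ;; δ ;; χ⁺ ;; η⁺⁺⁺ ;; δ⁺⁺⁺ ;; χ⁺⁺⁺⁺ ;; (μ⁺ ;; μ ;; ε)⁺⁺ ;; μ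
    : hom (Y ⊗ H ⊗ H) _); first by interchange.
rewrite eps_mul_assoc; symmetry.
transitivity (η⁺ ;; δ⁺ ;; χ⁺⁺ ;; μ ;; (δ⁺ ;; δ ;; χ⁺ ;; μ⁺⁺ ;; ε⁺⁺ ;; μ)
    : hom (Y ⊗ H ⊗ H) _); first by rewrite eps_delta_mul; norm.
transitivity ((η ;; δ)⁺ ;; χ⁺⁺ ;; μ ;; (δ⁺ ;; δ ;; χ⁺ ;; μ⁺⁺ ;; ε⁺⁺ ;; μ)
    : hom (Y ⊗ H ⊗ H) _); first by interchange.
(* Replacing 1_2 by PbarR(1_2) lets [PbarR_delta] give 1_2 l the coproduct 1_2 l_1 ⊗ l_2. *)
rewrite -delta_unit_PbarR.
transitivity (η⁺ ;; δ⁺ ;; χ⁺⁺ ;; (Π⁺ ;; μ ;; δ) ;; δ⁺⁺ ;; χ⁺ ;; μ⁺⁺ ;;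
    ε⁺⁺ ;; μ : hom (Y ⊗ H ⊗ H) _); first by interchange.
rewrite PbarR_delta.
transitivity ((η ;; δ ;; Π)⁺ ;; χ⁺⁺ ;; δ ;; μ⁺ ;; δ⁺⁺ ;; χ⁺ ;; μ⁺⁺ ;;
    ε⁺⁺ ;; μ : hom (Y ⊗ H ⊗ H) _); first by interchange.
rewrite delta_unit_PbarR.
transitivity (η⁺ ;; δ⁺ ;; (χ ;; δ)⁺⁺ ;; δ ;; (μ ;; χ)⁺ ;; μ⁺⁺ ;;
    ε⁺⁺ ;; μ : hom (Y ⊗ H ⊗ H) _); first by interchange.
rewrite -mu_braid_r -delta_braid_l.
transitivity (δ⁺ ;; (η ;; δ ;; χ⁺ ;; χ)⁺ ;; χ⁺⁺⁺ ;; δ ;; χ⁺ ;;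
    μ⁺⁺ ;; μ⁺⁺ ;; ε⁺⁺ ;; μ : hom (Y ⊗ H ⊗ H) _); first by interchange.
rewrite unit_braid_r.
by interchange.
Qed.

(** Since PbarR(a) = eps(a 1_1) 1_2, this is [unit_mul_assoc] with a multiplied onto the free leg
    1_1. *)
Lemma PbarR_mul_assoc_middle (Y : C) :
  Π⁺ ;; μ⁺ ;; μ = Π⁺ ;; μ ;; (μ : hom (Y ⊗ H ⊗ H) _).
Proof.
(* Here a is first braided to the left of its neighbour h, which produces 1_1 ⊗ h ⊗ 1_2 ⊗ l as in
   [unit_mul_assoc]. *)
have PbarR_braid (Z : C) (f : hom (Y ⊗ H ⊗ H ⊗ H) Z) :
    Π⁺ ;; f = χ⁺ ;; η⁺ ;; δ⁺ ;; χ⁺⁺ ;; μ⁺⁺⁺ ;; ε⁺⁺⁺ ;; f.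
  transitivity (η⁺ ;; δ⁺ ;; μ⁺⁺ ;; ε⁺⁺ ;; f : hom (Y ⊗ H ⊗ H ⊗ H) _).
    by rewrite PbarR_eps; norm.
  rewrite -eps_braid_r.
  transitivity (η⁺ ;; δ⁺ ;; (μ ;; χ)⁺⁺ ;; ε⁺⁺⁺ ;; f : hom (Y ⊗ H ⊗ H ⊗ H) _).
    by norm.
  rewrite -mu_braid_r.
  by interchange.
rewrite !PbarR_braid.
transitivity (χ⁺ ;; (η⁺ ;; δ⁺ ;; χ⁺⁺ ;; μ⁺ ;; μ) ;; μ⁺ ;; ε⁺
    : hom (Y ⊗ H ⊗ H ⊗ H) _); first by interchange.
by rewrite unit_mul_assoc; interchange.
Qed.

(** [PbarR] fixes PiL(l_1), which can therefore be bracketed with l_2, where [PiL_id] applies. This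
    becomes axiom [act_PiL] for [Y ⊗ H]. *)
Lemma PiL_mul_id (Y : C) :
  δ ;; ΠL⁺ ;; μ⁺ ;; μ = (μ : hom (Y ⊗ H ⊗ H) _).
Proof.
rewrite -PiL_PbarR.
transitivity (δ ;; ΠL⁺ ;; (Π⁺ ;; μ⁺ ;; μ) : hom (Y ⊗ H ⊗ H) _); first by norm.
rewrite PbarR_mul_assoc_middle.
transitivity (δ ;; (ΠL ;; Π)⁺ ;; μ ;; μ : hom (Y ⊗ H ⊗ H) _); first by norm.
rewrite PiL_PbarR.
transitivity ((δ ;; ΠL⁺ ;; μ) ;; μ : hom (Y ⊗ H ⊗ H) _); first by norm.
by rewrite PiL_id comp_idr.
Qed.

(* lambda(h_2)_1 ⊗ h_1 lambda(h_2)_2 = lambda(h_1) PiL(h_2)_1 ⊗ PiL(h_2)_2 *)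
Lemma antipode_delta (Y : C) :
  (δ : hom (Y ⊗ H) _) ;; λ ;; δ ;; χ⁺ ;; μ = δ ;; ΠL ;; δ ;; λ⁺⁺ ;; μ⁺.
Proof.
(* The right side is lambda(h_1) (h_2 lambda(h_4)_1) ⊗ h_3 lambda(h_4)_2. *)
symmetry; rewrite -PiL_antipode.
transitivity (δ ;; δ ;; λ ;; (μ ;; δ) ;; λ⁺⁺ ;; μ⁺ : hom (Y ⊗ H) _).
  by norm.
rewrite delta_mul.
transitivity ((δ ;; δ) ;; λ ;; δ⁺ ;; δ ;; χ⁺ ;; μ⁺⁺ ;; μ ;; λ⁺⁺ ;; μ⁺
  : hom (Y ⊗ H) _); first by norm.
rewrite -coassoc.
transitivity (δ ;; λ ;; δ ;; (δ ;; δ)⁺⁺ ;; χ⁺ ;; λ⁺⁺⁺⁺ ;; μ ;; μ⁺ ;; μ⁺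
  : hom (Y ⊗ H) _); first by interchange.
rewrite -coassoc.
transitivity (δ ;; λ ;; δ ;; δ⁺⁺ ;; χ⁺ ;; μ ;; (δ⁺ ;; λ⁺⁺ ;; μ ;; μ)⁺
  : hom (Y ⊗ H) _); first by interchange.
(* This leaves PiR(h_1) lambda(h_3)_1 ⊗ h_2 lambda(h_3)_2. *)
rewrite antipode_mul.
transitivity (δ ;; λ ;; δ ;; (δ ;; ΠR⁺)⁺⁺ ;; χ⁺ ;; μ ;; μ⁺
  : hom (Y ⊗ H) _); first by interchange.
rewrite -unit_mul_PiR.
transitivity (δ ;; λ ;; δ ;; ((η ;; δ) ;; χ⁺)⁺⁺ ;; (μ⁺ ;; χ)⁺ ;; μ ;; μ⁺
  : hom (Y ⊗ H) _); first by interchange.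
(* For x = lambda(h_2) the expression is now 1_1 x_1 ⊗ (h_1 1_2) x_2. Inserting [PbarR] on 1_2
   allows the bracket to move, and 1_1 x_1 ⊗ 1_2 x_2 is the coproduct of 1 x. *)
rewrite -mu_braid_l -delta_unit_PbarR.
transitivity (δ ;; λ ;; δ ;; (η ;; δ ;; χ⁺)⁺⁺ ;; (Π⁺ ;; χ)⁺ ;; χ⁺⁺ ;; μ⁺ ;;
   μ ;; μ⁺ : hom (Y ⊗ H) _); first by interchange.
rewrite act_on_braid.
transitivity (δ ;; λ ;; δ ;; (η ;; δ ;; χ⁺)⁺⁺ ;; χ⁺ ;; χ⁺⁺ ;; (Π⁺ ;; μ⁺ ;;
   μ) ;; μ⁺ : hom (Y ⊗ H) _); first by interchange.
rewrite PbarR_mul_assoc_middle.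
transitivity (δ ;; λ ;; δ ;; (η ;; δ ;; χ⁺)⁺⁺ ;; (χ ;; Π)⁺ ;; χ⁺⁺ ;; μ ;;
   μ ;; μ⁺ : hom (Y ⊗ H) _); first by interchange.
rewrite -act_on_braid.
transitivity (δ ;; λ ;; δ ;; ((η ;; δ ;; Π) ;; χ⁺)⁺⁺ ;; χ⁺ ;; χ⁺⁺ ;; μ ;;
   μ ;; μ⁺ : hom (Y ⊗ H) _); first by interchange.
rewrite delta_unit_PbarR.
transitivity (δ ;; λ ;; η⁺ ;; δ⁺ ;; δ ;; χ⁺ ;; (χ⁺ ;; χ ;; μ⁺)⁺⁺ ;; μ ;; μ
  : hom (Y ⊗ H) _); first by interchange.
rewrite mu_braid_r.
transitivity (δ ;; λ ;; η⁺ ;; (δ⁺ ;; δ ;; χ⁺ ;; μ⁺⁺ ;; μ) ;; χ⁺ ;; μ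
  : hom (Y ⊗ H) _); first by interchange.
rewrite -delta_mul.
transitivity (δ ;; λ ;; (η⁺ ;; μ) ;; δ ;; χ⁺ ;; μ
  : hom (Y ⊗ H) _); first by norm.
by rewrite mul_unit_l comp_idr.
Qed.
(** * Hopf modules *)

Record hopf_module_slices (M : hopf_data H) : Prop := {
  coact_counit : coact M ;; ε = idm M;
  coact_coassoc : coact M ;; (coact M)⁺ = coact M ;; δ;
  act_unit : η ;; act M = idm M;
  act_coact : act M ;; coact M =
    (coact M)⁺ ;; δ ;; χ⁺ ;; (act M)⁺⁺ ;; μ;
  act_antipode_r : δ ;; (act M)⁺ ;; λ ;; act M = ΠL ;; act M;
  act_antipode_l : δ ;; λ⁺ ;; (act M)⁺ ;; act M = ΠR ;; act M;
  act_PiL : δ ;; ΠL⁺ ;; (act M)⁺ ;; act M = act M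
}.

Lemma hopf_module_to_slices (M : hopf_data H) :
  is_hopf_module M -> hopf_module_slices M.
Proof.
case=> [[b1 b1'] b2 b2' b3 b4 b5]; split.
- by slices_of (eqm_heq b1).
- by slices_of (eqm_heq b1').
- by slices_of (eqm_heq b2).
- by slices_of (eqm_heq b2').
- by slices_of (eqm_heq b3).
- by slices_of (eqm_heq b4).
- by slices_of (eqm_heq b5).
Qed.

Lemma slices_to_hopf_module (M : hopf_data H) :
  hopf_module_slices M -> is_hopf_module M.
Proof.
case=> b1 b1' b2 b2' b3 b4 b5; split; [split | ..]; slices_goal; done.
Qed.

(** Apart from [PiL_mul_id], these are laws of [H] itself with a spectator factor [Y]. For [Y] the
    coinvariants, the coequalizer is a quotient of this module. *)
Lemma regular_hopf_module (Y : C) :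
  hopf_module_slices (@HopfData C H (Y ⊗ H) (mu_ H Y) (delta_ H Y)).
Proof.
split=> /=.
- exact: delta_counit_r.
- exact: coassoc.
- exact: mul_unit_r.
- exact: delta_mul.
- exact: mul_antipode_r.
- exact: mul_antipode_l.
- exact: PiL_mul_id.
Qed.

(** Each axiom equates morphisms out of [N] or [N ⊗ H], so it may be tested after [f] or [f ▷ H].
    This serves both the coequalizer and transport along the isomorphism. *)
Lemma quotient_hopf_module (M N : hopf_data H) (f : hom M N) :
  epi f -> epi (f ▷ H) -> (f ▷ H) ;; act N = act M ;; f ->
  f ;; coact N = coact M ;; (f ▷ H) ->
  hopf_module_slices M -> hopf_module_slices N.
Proof.
move=> epi_f epi_fH f_act f_coact [b1 b1' b2 b2' b3 b4 b5]; split.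
- apply: epi_f.
  transitivity ((f ;; coact N) ;; ε); first by norm.
  rewrite f_coact.
  transitivity ((coact M ;; ε) ;; f); first by interchange.
  by rewrite b1; norm.
- apply: epi_f.
  transitivity ((f ;; coact N) ;; (coact N)⁺); first by norm.
  rewrite f_coact.
  transitivity (coact M ;; (f ;; coact N)⁺); first by norm.
  rewrite f_coact.
  transitivity ((coact M ;; (coact M)⁺) ;; f⁺⁺); first by norm.
  rewrite b1'.
  transitivity ((coact M ;; f⁺) ;; δ); first by interchange.
  by rewrite -f_coact; norm.
- apply: epi_f.
  transitivity (η ;; (f⁺ ;; act N)); first by interchange.
  rewrite f_act.
  transitivity ((η ;; act M) ;; f); first by norm.
  by rewrite b2; norm.
- apply: epi_fH.
  transitivity ((f⁺ ;; act N) ;; coact N); first by norm.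
  rewrite f_act.
  transitivity (act M ;; (f ;; coact N)); first by norm.
  rewrite f_coact.
  transitivity ((act M ;; coact M) ;; f⁺); first by norm.
  rewrite b2'.
  transitivity ((coact M)⁺ ;; δ ;; χ⁺ ;; (act M ;; f)⁺⁺ ;; μ).
    by interchange.
  rewrite -f_act.
  transitivity ((coact M ;; f⁺)⁺ ;; δ ;; χ⁺ ;; (act N)⁺⁺ ;; μ).
    by interchange.
  by rewrite -f_coact; norm.
- apply: epi_fH.
  transitivity (δ ;; (f⁺ ;; act N)⁺ ;; λ ;; act N); first by interchange.
  rewrite f_act.
  transitivity (δ ;; (act M)⁺ ;; λ ;; (f⁺ ;; act N)); first by interchange.
  rewrite f_act.
  transitivity ((δ ;; (act M)⁺ ;; λ ;; act M) ;; f); first by norm.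
  rewrite b3.
  transitivity (ΠL ;; (act M ;; f)); first by norm.
  by rewrite -f_act; interchange.
- apply: epi_fH.
  transitivity (δ ;; λ⁺ ;; (f⁺ ;; act N)⁺ ;; act N); first by interchange.
  rewrite f_act.
  transitivity (δ ;; λ⁺ ;; (act M)⁺ ;; (f⁺ ;; act N)); first by interchange.
  rewrite f_act.
  transitivity ((δ ;; λ⁺ ;; (act M)⁺ ;; act M) ;; f); first by norm.
  rewrite b4.
  transitivity (ΠR ;; (act M ;; f)); first by norm.
  by rewrite -f_act; interchange.
- apply: epi_fH.
  transitivity (δ ;; ΠL⁺ ;; (f⁺ ;; act N)⁺ ;; act N); first by interchange.
  rewrite f_act.
  transitivity (δ ;; ΠL⁺ ;; (act M)⁺ ;; (f⁺ ;; act N)); first by interchange.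
  rewrite f_act.
  transitivity ((δ ;; ΠL⁺ ;; (act M)⁺ ;; act M) ;; f); first by norm.
  by rewrite b5.
Qed.

(** [act_alpha] is built from [act], [coact] and morphisms of [H], so [f] passes through it factor
    by factor. *)
Lemma strict_hopf_morphism (M N : hopf_data H) (f : hom M N) :
  (f ▷ H) ;; act N = act M ;; f -> f ;; coact N = coact M ;; (f ▷ H) ->
  is_hopf_morphism f.
Proof.
move=> f_act f_coact; split; first exact: f_coact.
rewrite /act_alpha /q_hm; slices_goal.
transitivity ((f ;; coact N)⁺ ;; (coact N)⁺⁺ ;; λ⁺⁺ ;; (act N)⁺⁺ ;; μ ;; act N).
  by norm.
rewrite f_coact.
transitivity ((coact M)⁺ ;; (f ;; coact N)⁺⁺ ;; λ⁺⁺ ;; (act N)⁺⁺ ;; μ ;; act N).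
  by norm.
rewrite f_coact.
transitivity ((coact M)⁺ ;; (coact M)⁺⁺ ;; λ⁺⁺ ;; (f⁺ ;; act N)⁺⁺ ;;
  μ ;; act N).
  by interchange.
rewrite f_act.
transitivity ((coact M)⁺ ;; (coact M)⁺⁺ ;; λ⁺⁺ ;; (act M)⁺⁺ ;;
  μ ;; (f⁺ ;; act N)).
  by interchange.
by rewrite f_act; norm.
Qed.

(** * Coinvariants, [nabla] and the pair to be coequalized *)

Section Coinvariants.

Context (M : hopf_data H) (hM : hopf_module_slices M).
Context (N : C) (p : hom M N) (i : hom N M).
Hypotheses (ip : p ;; i = q_hm M) (pi : i ;; p = idm N).

Local Notation "'φ'" := (act M).
Local Notation "'ρ'" := (coact M).
Local Notation q := (q_hm M).

Lemma q_slices : q = ρ ;; λ ;; φ.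
Proof.
have E := eq_heq (eq_refl : act M ∘ (M ◁ lambda H) ∘ coact M = q_hm M).
by slices_of E.
Qed.

Lemma i_q : i ;; q = i.
Proof. by rewrite -ip -comp_assoc pi comp_idr. Qed.

(* rho(q m) lies in M ⊗ H_L *)
Lemma coact_q_PbarR : q ;; ρ ;; Π = q ;; ρ.
Proof.
(* That is, rho(q m) = m_0 (lambda(m_1) PiL(m_2)_1) ⊗ PiL(m_2)_2, whose last leg [PbarR] fixes. *)
have coact_q : q ;; ρ = ρ ;; δ ;; ΠL ;; δ ;; λ⁺⁺ ;; μ⁺ ;; φ⁺.
  rewrite q_slices.
  transitivity (ρ ;; λ ;; (φ ;; ρ)); first by norm.
  rewrite (act_coact hM).
  transitivity ((ρ ;; ρ⁺) ;; λ ;; δ ;; χ⁺ ;; μ ;; φ⁺); first by interchange.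
  rewrite (coact_coassoc hM).
  transitivity (ρ ;; (δ ;; λ ;; δ ;; χ⁺ ;; μ) ;; φ⁺); first by norm.
  by rewrite antipode_delta; norm.
transitivity ((q ;; ρ) ;; Π); first by norm.
rewrite coact_q.
transitivity (ρ ;; δ ;; (ΠL ;; δ ;; Π) ;; λ⁺⁺ ;; μ⁺ ;; φ⁺).
  by interchange.
by rewrite PiL_delta_PbarR; norm.
Qed.

(* rho(x h) = x_0 h_1 ⊗ PbarR(x_1) h_2 = x_0 h_1 eps(x_1 h_2) ⊗ h_3
   = x h_1 ⊗ h_2 *)
Lemma coact_coinv : i⁺ ;; φ ;; ρ = i⁺ ;; δ ;; φ⁺.
Proof.
rewrite -i_q (act_coact hM).
transitivity (i⁺ ;; (q ;; ρ)⁺ ;; δ ;; χ⁺ ;; φ⁺⁺ ;; μ); first by norm.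
rewrite -coact_q_PbarR.
transitivity (i⁺ ;; q⁺ ;; ρ⁺ ;; δ ;; (Π⁺ ;; χ)⁺ ;; φ⁺⁺ ;; μ).
  by interchange.
rewrite act_on_braid.
transitivity (i⁺ ;; q⁺ ;; ρ⁺ ;; δ ;; χ⁺ ;; φ⁺⁺ ;; (Π⁺ ;; μ)).
  by interchange.
rewrite PbarR_mul.
transitivity (i⁺ ;; q⁺ ;; ρ⁺ ;; (δ ;; δ) ;; χ⁺⁺ ;; φ⁺⁺⁺ ;; μ⁺ ;; ε⁺).
  by interchange.
rewrite -coassoc.
transitivity (i⁺ ;; q⁺ ;; δ ;; (ρ⁺ ;; δ ;; χ⁺ ;; φ⁺⁺ ;; μ)⁺ ;; ε⁺).
  by interchange.
rewrite -(act_coact hM).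
transitivity (i⁺ ;; q⁺ ;; δ ;; φ⁺ ;; (ρ ;; ε)⁺); first by norm.
by rewrite (coact_counit hM) tensm_id comp_idl; norm.
Qed.

(** By [coact_coinv], q(x h) = (x h_1) lambda(h_2), which [act_antipode_r] contracts. *)
Lemma q_coinv : i⁺ ;; φ ;; q = i⁺ ;; ΠL ;; φ.
Proof.
rewrite q_slices.
transitivity ((i⁺ ;; φ ;; ρ) ;; λ ;; φ); first by norm.
rewrite coact_coinv.
transitivity (i⁺ ;; (δ ;; φ⁺ ;; λ ;; φ)); first by norm.
by rewrite (act_antipode_r hM).
Qed.

Lemma nabla_slices : nabla p i = i⁺ ;; φ ;; ρ ;; p⁺.
Proof. by rewrite /nabla; slices_goal. Qed.

Context (HL : C) (pL : hom H HL) (iL : hom HL H).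
Hypotheses (ipL : pL ;; iL = PiL H) (piL : iL ;; pL = idm HL).

Local Notation psi := (psi_co p i iL).

Lemma psi_slices : psi = i ▷ HL ;; ⟦iL⟧ ;; φ ;; p.
Proof. by rewrite /psi_co; slices_goal. Qed.

Lemma phi_L_slices (Y : C) :
  retype (Y ◁ phi_L iL) = ⟦iL⟧⁺ ;; (μ : hom (Y ⊗ H ⊗ H) _).
Proof. by rewrite /phi_L; slices_goal. Qed.

Lemma act_on_comp (Y A B D : C) (f : hom A B) (g : hom B D) :
  (act_on Y f) ;; ⟦g⟧ = ⟦f ;; g⟧.
Proof. by rewrite /act_on tensm_compl. Qed.

Lemma iL_PiL (Y : C) : (act_on Y iL) ;; ΠL = ⟦iL⟧.
Proof. by rewrite act_on_comp -ipL -comp_assoc piL comp_idr. Qed.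

Lemma iL_PbarR (Y : C) : (act_on Y iL) ;; Π = ⟦iL⟧.
Proof.
rewrite -[in LHS]iL_PiL comp_assoc.
by rewrite PiL_PbarR iL_PiL.
Qed.

Lemma iL_mul_assoc (Y : C) :
  (act_on Y iL)⁺⁺ ;; μ⁺ ;; μ = ⟦iL⟧⁺⁺ ;; μ ;; μ.
Proof.
rewrite -iL_PbarR.
transitivity ((act_on Y iL)⁺⁺ ;; (Π⁺⁺ ;; μ⁺ ;; μ)); first by norm.
by rewrite PbarR_mul_assoc; norm.
Qed.

Lemma iL_mul_delta (Y : C) :
  (act_on Y iL)⁺ ;; μ ;; δ = ⟦iL⟧⁺ ;; δ ;; μ⁺.
Proof.
rewrite -iL_PbarR.
transitivity ((act_on Y iL)⁺ ;; (Π⁺ ;; μ ;; δ)); first by norm.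
by rewrite PbarR_delta; norm.
Qed.

(** For z in H_L, [q_coinv] gives q(x z) = x PiL(z) = x z. So psi(x ⊗ z) is included in [M] as x z
    itself, and strongness applies to (x z) h. *)
Lemma psi_nabla : is_strong iL M ->
  psi⁺ ;; nabla p i = ⟦iL⟧⁺ ;; μ ;; nabla p i.
Proof.
move=> strong.
have {}strong : ⟦iL⟧⁺ ;; φ⁺ ;; φ = ⟦iL⟧⁺ ;; μ ;; φ.
  by slices_of (eqm_heq strong).
have psi_i : psi ;; i = i ▷ HL ;; ⟦iL⟧ ;; φ.
  rewrite psi_slices.
  transitivity (i ▷ HL ;; ⟦iL⟧ ;; φ ;; (p ;; i)); first by norm.
  rewrite ip.
  transitivity (⟦iL⟧ ;; (i⁺ ;; φ ;; q)); first by interchange.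
  rewrite q_coinv.
  transitivity (i ▷ HL ;; (⟦iL⟧ ;; ΠL) ;; φ); first by interchange.
  by rewrite iL_PiL.
rewrite nabla_slices.
transitivity ((psi ;; i)⁺ ;; φ ;; ρ ;; p⁺); first by norm.
rewrite psi_i.
transitivity ((i ▷ HL)⁺ ;; (⟦iL⟧⁺ ;; φ⁺ ;; φ) ;; ρ ;; p⁺); first by norm.
by rewrite strong; interchange.
Qed.

Lemma nabla_coequalizing (Q : C) (n : hom (N ⊗ H) Q) :
  psi⁺ ;; n = ⟦iL⟧⁺ ;; μ ;; n -> nabla p i ;; n = n.
Proof.
move=> psi_n.
rewrite nabla_slices.
transitivity ((i⁺ ;; φ ;; ρ) ;; p⁺ ;; n); first by norm.
rewrite coact_coinv.
(* The inserted q turns p(x h_1) into p(x PiL(h_1)), which is psi(x ⊗ pL(h_1)), so the hypothesis on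
   [n] applies. *)
have -> : p = q ;; p by rewrite -ip comp_assoc pi comp_idl.
transitivity (δ ;; (i⁺ ;; φ ;; q)⁺ ;; p⁺ ;; n); first by interchange.
rewrite q_coinv -ipL -act_on_comp.
transitivity (δ ;; ⟦pL⟧⁺ ;; ((i ▷ HL ;; ⟦iL⟧ ;; φ ;; p)⁺ ;; n)).
  by interchange.
rewrite -psi_slices psi_n.
transitivity (δ ;; (⟦pL⟧ ;; ⟦iL⟧)⁺ ;; μ ;; n); first by norm.
rewrite act_on_comp ipL.
transitivity ((δ ;; ΠL⁺ ;; μ) ;; n); first by norm.
by rewrite PiL_id comp_idr.
Qed.

End Coinvariants.
End WeakHopfQuasigroup.

(** * The isomorphism between the quotient and the image of [nabla] *)

Theorem proposition3p9 (C : strict_braided)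
    (hsplit : idempotents_split C) (hcoeq : has_coequalizers C)
    (H : weak_hopf_quasigroup C) (hpres : tensr_preserves_coequalizers H)
    (HL : C) (pL : hom H HL) (iL : hom HL H) (hL : is_splitting (PiL H) pL iL)
    (M : hopf_data H) (hM : is_hopf_module M) (hstrong : is_strong iL M)
    (McoH : C) (pM : hom M McoH) (iM : hom McoH M)
    (hMcoH : is_splitting (q_hm M) pM iM)
    (X : C) (pX : hom (McoH ⊗ H) X) (iX : hom X (McoH ⊗ H))
    (hX : is_splitting (nabla pM iM) pX iX)
    (Q : C) (n : hom (McoH ⊗ H) Q)
    (hQ : is_tensor_over_HL iL (psi_co pM iM iL) n) :
  exists (phiQ : hom (Q ⊗ H) Q) (rhoQ : hom Q (Q ⊗ H)),
    unique (fun phi : hom (Q ⊗ H) Q =>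
      phi ∘ (n ▷ H) ≡ n ∘ (McoH ◁ mu H)) phiQ /\
    unique (fun rho : hom Q (Q ⊗ H) =>
      rho ∘ n ≡ (n ▷ H) ∘ (McoH ◁ delta H)) rhoQ /\
    hopf_module_iso (HopfData Q phiQ rhoQ) (times_hopf pX iX).
Proof.
have [ipL piL] := hL; have [ip pi] := hMcoH; have [ipX piX] := hX.
have {}hM := hopf_module_to_slices hM.
set psi := psi_co pM iM iL in hQ.
have hQH := hpres _ _ _ _ _ _ hQ.
have epi_n := coequalizer_epi hQ; have epi_nH := coequalizer_epi hQH.
have psi_n : psi⁺ ;; n = (act_on McoH iL)⁺ ;; mu_ H McoH ;; n.
  by have := proj1 hQ; rewrite phi_L_slices; norm.
(* The action is defined on [Q ⊗ H], hence the coequalizer preserved by tensoring with [H];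
   [iL_mul_assoc] supplies the compatibility with the pair. *)
have [phiQ [n_act phiQ_uniq]] :
    exists! phi : hom (Q ⊗ H) Q, n ▷ H ;; phi = mu_ H McoH ;; n.
  apply: (proj2 hQH); rewrite phi_L_slices.
  transitivity (mu_ H _ ;; (psi⁺ ;; n)); first by interchange.
  rewrite psi_n.
  transitivity (((act_on McoH iL)⁺⁺ ;; mu_ H _ ;; mu_ H _) ;; n).
    by interchange.
  by rewrite -(iL_mul_assoc ipL piL); norm.
have [rhoQ [n_coact rhoQ_uniq]] :
    exists! rho : hom Q (Q ⊗ H), n ;; rho = delta_ H McoH ;; n ▷ H.
  apply: (proj2 hQ); rewrite phi_L_slices.
  transitivity (delta_ H _ ;; (psi⁺ ;; n)⁺); first by interchange.
  rewrite psi_n.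
  transitivity (((act_on McoH iL)⁺ ;; delta_ H _ ;; (mu_ H _)⁺) ;; n⁺).
    by interchange.
  by rewrite -(iL_mul_delta ipL piL); norm.
have nabla_n : nabla pM iM ;; n = n.
  exact: (nabla_coequalizing hM ip pi ipL).
have [f [n_f _]] : exists! f : hom Q X, n ;; f = pX.
  apply: (proj2 hQ); rewrite phi_L_slices.
  (* Since [pX] absorbs [nabla], it inherits compatibility with the pair from [psi_nabla]. *)
  have -> : pX = nabla pM iM ;; pX by rewrite -ipX comp_assoc piX comp_idl.
  transitivity ((psi⁺ ;; nabla pM iM) ;; pX); first by norm.
  by rewrite (psi_nabla hM ip pi ipL piL hstrong); norm.
pose g := iX ;; n.
have gf : g ;; f = idm X by rewrite comp_assoc n_f piX.
have fg : f ;; g = idm Q.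
  apply: epi_n.
  by rewrite -!comp_assoc n_f ipX nabla_n comp_idl.
have act_X : act (times_hopf pX iX) = iX⁺ ;; mu_ H McoH ;; pX.
  by rewrite /=; slices_goal.
have coact_X : coact (times_hopf pX iX) = iX ;; delta_ H McoH ;; pX⁺.
  by rewrite /=; slices_goal.
have f_act : f ▷ H ;; act (times_hopf pX iX) = phiQ ;; f.
  (* Writing [pX] as [n ;; f] exposes [mu_] followed by [n]; afterwards [pX ;; iX] is [nabla], which
     [n] absorbs. *)
  apply: epi_nH; rewrite act_X -n_f.
  transitivity ((n ;; f)⁺ ;; iX⁺ ;; (mu_ H _ ;; n) ;; f); first by norm.
  rewrite -n_act n_f.
  transitivity (((pX ;; iX) ;; n)⁺ ;; phiQ ;; f); first by norm.
  by rewrite ipX nabla_n.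
have f_coact : f ;; coact (times_hopf pX iX) = rhoQ ;; f ▷ H.
  apply: epi_n; rewrite coact_X -n_f.
  transitivity ((n ;; f) ;; iX ;; (delta_ H _ ;; n⁺) ;; f⁺); first by norm.
  rewrite -n_coact n_f.
  transitivity (((pX ;; iX) ;; n) ;; rhoQ ;; f⁺); first by norm.
  by rewrite ipX nabla_n.
have g_act : g ▷ H ;; phiQ = act (times_hopf pX iX) ;; g.
  transitivity (g⁺ ;; phiQ ;; (f ;; g)); first by rewrite fg; norm.
  transitivity (g⁺ ;; (phiQ ;; f) ;; g); first by norm.
  rewrite -f_act.
  transitivity ((g ;; f)⁺ ;; act (times_hopf pX iX) ;; g); first by norm.
  by rewrite gf tensm_id comp_idr.
have g_coact : g ;; rhoQ = coact (times_hopf pX iX) ;; g ▷ H.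
  transitivity (g ;; rhoQ ;; (f ;; g)⁺); first by rewrite fg; norm.
  transitivity (g ;; (rhoQ ;; f⁺) ;; g⁺); first by norm.
  rewrite -f_coact.
  transitivity ((g ;; f) ;; coact (times_hopf pX iX) ;; g⁺); first by norm.
  by rewrite gf comp_idr.
have hopf_Q : hopf_module_slices (@HopfData C H Q phiQ rhoQ).
  exact: (@quotient_hopf_module C H (@HopfData C H _ (mu_ H McoH)
    (delta_ H McoH)) (@HopfData C H Q phiQ rhoQ) n epi_n epi_nH n_act n_coact
    (regular_hopf_module H McoH)).
have epi_f : epi f by exact: split_epi gf.
have epi_fH : epi (f ▷ H).
  by apply: (@split_epi _ _ _ _ (g ▷ H)); rewrite -tensm_compr gf tensm_id.
exists phiQ, rhoQ; split; [split | split; [split | split; [| split]]].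
- by slices_goal.
- by move=> phi E; apply: phiQ_uniq; slices_of (eqm_heq E).
- by slices_goal.
- by move=> rho E; apply: rhoQ_uniq; slices_of (eqm_heq E).
- exact: slices_to_hopf_module hopf_Q.
- apply: slices_to_hopf_module.
  exact: (@quotient_hopf_module C H (@HopfData C H Q phiQ rhoQ)
    (times_hopf pX iX) f epi_f epi_fH f_act f_coact hopf_Q).
- exists f, g; split; [| split; [| split]].
  + exact: strict_hopf_morphism.
  + exact: strict_hopf_morphism.
  + exact: fg.
  + exact: gf.
Qed.
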